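(* Let $\phi$ be a Schröder map such that $C_{\phi}$ is complex symmetric on $H^2(\mathbb{D})$. Then each $A\in C_{\phi}'$ is also complex symmetric, where $C_\phi'$ is the commutant of $C_\phi$, i.e. the set of bounded linear operators $A$ on $H^2(\mathbb{D})$ with $AC_\phi=C_\phi A$.
   Context: $\mathbb{D}$ is the open unit disk in $\mathbb{C}$. $H^2(\mathbb{D})$ is the Hardy space of analytic functions $f(z)=\sum_{n\ge 0}\widehat f(n)z^n$ on $\mathbb{D}$ with $\sum_n|\widehat f(n)|^2<\infty$, a Hilbert space with inner product $\langle f,g\rangle=\sum_n\widehat f(n)\overline{\widehat g(n)}$. For an analytic self-map $\phi$ of $\mathbb{D}$, the composition operator is $C_\phi f=f\circ\phi$; it is bounded on $H^2(\mathbb{D})$. A Schröder map is an analytic map $\phi:\mathbb{D}\to\mathbb{D}$ that fixes a point $a\in\mathbb{D}$ with $0<|\phi'(a)|<1$. A conjugation on a Hilbert space $\mathcal{H}$ is a conjugate-linear map $J:\mathcal{H}\to\mathcal{H}$ with $\langle Jf,Jg\rangle=\langle g,f\rangle$ for all $f,g\in\mathcal{H}$ and $J^2=I$. A bounded operator $T$ on $\mathcal{H}$ is complex symmetric if $JT=T^*J$ for some conjugation $J$ on $\mathcal{H}$. *)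

(* Defs.v *)
From Stdlib Require Import Reals Lra Lia.
From Stdlib Require Import FunctionalExtensionality ProofIrrelevance ClassicalEpsilon.
From Coquelicot Require Import Coquelicot.

Local Open Scope R_scope.

(** ** The disk and its analytic self-maps *)

Record disk : Type := mkDisk { disk_val :> C; disk_lt : Cmod disk_val < 1 }.

(** Coquelicot differentiates functions defined on all of [C], so a function on
    the disk is first extended by [0]; as the disk is open, the values outside
    play no role in [is_derive] at a point of the disk. *)
Definition extend (f : disk -> C) (z : C) : C :=
  match Rlt_dec (Cmod z) 1 with
  | left h => f (mkDisk z h)
  | right _ => RtoC 0
  end.

Definition has_derivative (f : disk -> C) (a : disk) (l : C) : Prop :=
  @is_derive C_AbsRing C_NormedModule (extend f) (disk_val a) l.

Definition analytic (f : disk -> C) : Prop :=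
  forall z : disk, exists l : C, has_derivative f z l.

Definition schroder_map (phi : disk -> disk) : Prop :=
  analytic (fun z => phi z) /\
  exists (a : disk) (l : C),
    phi a = a /\ has_derivative (fun z => phi z) a l /\ 0 < Cmod l < 1.

(** ** Square-summable sequences *)

Definition sq_summable (a : nat -> C) : Prop :=
  ex_series (fun n => Cmod (a n) ^ 2).

Definition sq_sum (a : nat -> C) : R := Series (fun n => Cmod (a n) ^ 2).

Lemma sq_summable_plus (a b : nat -> C) :
  sq_summable a -> sq_summable b -> sq_summable (fun n => Cplus (a n) (b n)).
Proof.
intros Ha Hb.
apply (ex_series_le (V := R_CompleteNormedModule) _
         (fun n => 2 * Cmod (a n) ^ 2 + 2 * Cmod (b n) ^ 2)).
- intros n; change norm with Rabs.
  rewrite Rabs_pos_eq by apply pow2_ge_0.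
  pose proof (Cmod_triangle (a n) (b n)).
  pose proof (Cmod_ge_0 (Cplus (a n) (b n))).
  pose proof (pow2_ge_0 (Cmod (a n) - Cmod (b n))).
  pose proof (pow_incr _ _ 2 (conj H0 H)); nra.
- apply (ex_series_plus (fun n => 2 * Cmod (a n) ^ 2) (fun n => 2 * Cmod (b n) ^ 2)).
  + exact (ex_series_scal_l 2 _ Ha).
  + exact (ex_series_scal_l 2 _ Hb).
Qed.

Lemma sq_summable_scal (k : C) (a : nat -> C) :
  sq_summable a -> sq_summable (fun n => Cmult k (a n)).
Proof.
intros Ha.
apply (ex_series_ext (fun n => Cmod k ^ 2 * Cmod (a n) ^ 2)).
- intros n; rewrite Cmod_mult; simpl; ring.
- exact (ex_series_scal_l _ _ Ha).
Qed.

Lemma sq_sum_ge0 (a : nat -> C) : sq_summable a -> 0 <= sq_sum a.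
Proof.
intros Ha; unfold sq_sum.
rewrite <- (Rmult_0_l (Series (fun n => Cmod (a n) ^ 2))), <- Series_scal_l.
apply Series_le; [|exact Ha].
intros n; pose proof (pow2_ge_0 (Cmod (a n))); lra.
Qed.

Lemma sq_sum_scal (k : C) (a : nat -> C) :
  sq_sum (fun n => Cmult k (a n)) = Cmod k ^ 2 * sq_sum a.
Proof.
unfold sq_sum; rewrite <- Series_scal_l; apply Series_ext; intros n.
rewrite Cmod_mult; simpl; ring.
Qed.

Lemma sq_sum_triangle (a b : nat -> C) :
  sq_summable a -> sq_summable b ->
  sqrt (sq_sum (fun n => Cplus (a n) (b n))) <= sqrt (sq_sum a) + sqrt (sq_sum b).
Proof.
intros Ha Hb; apply le_epsilon; intros e He.
pose proof (sq_sum_ge0 a Ha) as A0; pose proof (sq_sum_ge0 b Hb) as B0.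
pose proof (sqrt_pos (sq_sum a)) as SA; pose proof (sqrt_pos (sq_sum b)) as SB.
set (p := sqrt (sq_sum a) + e / 2); set (q := sqrt (sq_sum b) + e / 2).
assert (Hp : 0 < p) by (unfold p; lra).
assert (Hq : 0 < q) by (unfold q; lra).
replace (_ + _ + e) with (p + q) by (unfold p, q; field).
rewrite <- (sqrt_pow2 (p + q)) by lra.
apply sqrt_le_1_alt.
assert (HA : sq_sum a <= p ^ 2).
{ rewrite <- (pow2_sqrt (sq_sum a) A0); apply pow_incr; unfold p; lra. }
assert (HB : sq_sum b <= q ^ 2).
{ rewrite <- (pow2_sqrt (sq_sum b) B0); apply pow_incr; unfold q; lra. }
apply Rle_trans with ((1 + q / p) * sq_sum a + (1 + p / q) * sq_sum b).
- unfold sq_sum; rewrite <- !Series_scal_l, <- Series_plus.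
  + apply Series_le.
    * intros n; split; [apply pow2_ge_0|].
      apply Rle_trans with ((Cmod (a n) + Cmod (b n)) ^ 2).
      -- apply pow_incr; split; [apply Cmod_ge_0|apply Cmod_triangle].
      -- set (x := Cmod (a n)); set (y := Cmod (b n)).
         assert (0 <= (q * x - p * y) ^ 2 / (p * q)).
         { apply Rdiv_le_0_compat; [apply pow2_ge_0|nra]. }
         replace ((q * x - p * y) ^ 2 / (p * q))
           with ((1 + q / p) * x ^ 2 + (1 + p / q) * y ^ 2 - (x + y) ^ 2) in H
           by (field; lra).
         lra.
    * apply (ex_series_plus (fun n => (1 + q / p) * Cmod (a n) ^ 2)
               (fun n => (1 + p / q) * Cmod (b n) ^ 2)).
      -- exact (ex_series_scal_l _ _ Ha).
      -- exact (ex_series_scal_l _ _ Hb).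
  + exact (ex_series_scal_l _ _ Ha).
  + exact (ex_series_scal_l _ _ Hb).
- assert (0 < q / p) by (apply Rdiv_lt_0_compat; lra).
  assert (0 < p / q) by (apply Rdiv_lt_0_compat; lra).
  apply Rle_trans with ((1 + q / p) * p ^ 2 + (1 + p / q) * q ^ 2).
  + apply Rplus_le_compat; apply Rmult_le_compat_l; lra.
  + right; field; lra.
Qed.

Lemma sq_sum_eq0 (a : nat -> C) :
  sq_summable a -> sq_sum a = 0 -> forall n, a n = RtoC 0.
Proof.
intros Ha H0 n; apply Cmod_eq_0.
assert (H : sum_n (fun n => Cmod (a n) ^ 2) n <= sq_sum a).
{ apply (is_lim_seq_incr_compare (sum_n (fun n => Cmod (a n) ^ 2)) (sq_sum a)).
  - exact (Series_correct _ Ha).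
  - intros m; rewrite sum_Sn; change plus with Rplus.
    pose proof (pow2_ge_0 (Cmod (a (S m)))); lra. }
assert (Hs : forall m, 0 <= sum_n (fun n => Cmod (a n) ^ 2) m).
{ induction m as [|m IH].
  - rewrite sum_O; apply pow2_ge_0.
  - rewrite sum_Sn; change plus with Rplus.
    pose proof (pow2_ge_0 (Cmod (a (S m)))); lra. }
assert (Hn : Cmod (a n) ^ 2 <= sum_n (fun n => Cmod (a n) ^ 2) n).
{ destruct n as [|m].
  - rewrite sum_O; lra.
  - rewrite sum_Sn; change plus with Rplus; specialize (Hs m); lra. }
pose proof (Cmod_ge_0 (a n)); nra.
Qed.

(** ** The Hardy space *)

(** A function given on the disk by a convergent power series is analytic. *)
Definition in_H2 (f : disk -> C) : Prop :=
  exists a : nat -> C,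
    (forall z : disk, @is_pseries C_AbsRing C_NormedModule a (disk_val z) (f z)) /\
    sq_summable a.

Record H2 : Type := mkH2 { H2_fun :> disk -> C; H2_in : in_H2 H2_fun }.

Lemma H2_ext (f g : H2) : (forall z, f z = g z) -> f = g.
Proof.
destruct f as [f Hf], g as [g Hg]; simpl; intros H.
assert (E : f = g) by (apply functional_extensionality; exact H).
subst g; f_equal; apply proof_irrelevance.
Qed.

Definition coef (f : H2) : nat -> C :=
  proj1_sig (constructive_indefinite_description _ (H2_in f)).

Lemma coef_pseries (f : H2) (z : disk) :
  @is_pseries C_AbsRing C_NormedModule (coef f) (disk_val z) (f z).
Proof.
exact (proj1 (proj2_sig (constructive_indefinite_description _ (H2_in f))) z).
Qed.

Lemma coef_sq_summable (f : H2) : sq_summable (coef f).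
Proof.
exact (proj2 (proj2_sig (constructive_indefinite_description _ (H2_in f)))).
Qed.

Lemma pow_n_RtoC (x : R) (n : nat) :
  @pow_n C_AbsRing (RtoC x) n = RtoC (x ^ n).
Proof.
induction n as [|n IH]; [reflexivity|].
change (Cmult (RtoC x) (@pow_n C_AbsRing (RtoC x) n) = RtoC (x * x ^ n)).
rewrite IH, RtoC_mult; reflexivity.
Qed.

Lemma is_pseries_Re_Im (a : nat -> C) (x : R) (l : C) :
  @is_pseries C_AbsRing C_NormedModule a (RtoC x) l ->
  is_pseries (fun n => Re (a n)) x (Re l) /\ is_pseries (fun n => Im (a n)) x (Im l).
Proof.
intros H.
assert (E : forall N,
  sum_n (fun k => @scal C_AbsRing C_NormedModule (@pow_n C_AbsRing (RtoC x) k) (a k)) N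
  = (sum_n (fun k => scal (pow_n x k) (Re (a k))) N,
     sum_n (fun k => scal (pow_n x k) (Im (a k))) N) :> C).
{ assert (E0 : forall n,
    @scal C_AbsRing C_NormedModule (@pow_n C_AbsRing (RtoC x) n) (a n)
    = (scal (pow_n x n) (Re (a n)), scal (pow_n x n) (Im (a n))) :> C).
  { intros n; rewrite pow_n_RtoC, <- (pow_n_pow x n : @pow_n R_Ring x n = x ^ n).
    unfold scal; simpl; unfold mult; simpl; unfold Cmult, Re, Im; simpl.
    f_equal; ring. }
  induction N as [|N IH].
  - rewrite !sum_O; apply E0.
  - rewrite !sum_Sn, IH, E0; reflexivity. }
unfold is_pseries, is_series in *.
split; apply filterlim_locally; intros eps;
  generalize (proj1 (filterlim_locally _ _) H eps); apply filter_imp;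
  intros N HN; rewrite E in HN; apply HN.
Qed.

Lemma pseries_coef_unique (a b : nat -> C) (f : disk -> C) :
  (forall z : disk, @is_pseries C_AbsRing C_NormedModule a (disk_val z) (f z)) ->
  (forall z : disk, @is_pseries C_AbsRing C_NormedModule b (disk_val z) (f z)) ->
  forall n, a n = b n.
Proof.
intros Ha Hb n.
assert (D : forall x : R, Rabs x < 1 -> exists z : disk, disk_val z = RtoC x).
{ intros x Hx.
  assert (h : Cmod (RtoC x) < 1) by (rewrite Cmod_R; exact Hx).
  exists (mkDisk _ h); reflexivity. }
assert (K : forall c d : nat -> R,
  (forall x, Rabs x < 1 -> exists l, is_pseries c x l /\ is_pseries d x l) ->
  c n = d n).
{ intros c d H.
  assert (G : forall e, ex_pseries e (1 / 2) -> Rbar_lt 0 (CV_radius e)).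
  { intros e He; apply Rbar_lt_le_trans with (Finite (1 / 2)); [simpl; lra|].
    destruct (Rbar_le_lt_dec (1 / 2) (CV_radius e)) as [h|h]; [exact h|exfalso].
    apply (CV_disk_outside e (1 / 2)).
    - rewrite Rabs_pos_eq by lra; exact h.
    - apply ex_series_lim_0; destruct He as [l Hl]; exists l.
      eapply is_series_ext; [|exact Hl].
      intros k; unfold scal; simpl; unfold mult; simpl.
      rewrite pow_n_pow; ring. }
  destruct (H (1 / 2)) as [l [H1 H2]]; [rewrite Rabs_pos_eq; lra|].
  apply PSeries_ext_recip.
  - apply G; exists l; exact H1.
  - apply G; exists l; exact H2.
  - exists (mkposreal 1 Rlt_0_1); intros x Hx.
    destruct (H x) as [m [Hc Hd]].
    + change (Rabs (x - 0) < 1) in Hx; rewrite Rminus_0_r in Hx; exact Hx.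
    + rewrite (is_pseries_unique _ _ _ Hc), (is_pseries_unique _ _ _ Hd); reflexivity. }
apply injective_projections.
- apply (K (fun n => Re (a n)) (fun n => Re (b n))); intros x Hx.
  destruct (D x Hx) as [z Hz]; exists (Re (f z)).
  specialize (Ha z); specialize (Hb z); rewrite Hz in Ha, Hb.
  split; apply is_pseries_Re_Im; assumption.
- apply (K (fun n => Im (a n)) (fun n => Im (b n))); intros x Hx.
  destruct (D x Hx) as [z Hz]; exists (Im (f z)).
  specialize (Ha z); specialize (Hb z); rewrite Hz in Ha, Hb.
  split; apply is_pseries_Re_Im; assumption.
Qed.

Lemma coef_unique (f : H2) (a : nat -> C) :
  (forall z : disk, @is_pseries C_AbsRing C_NormedModule a (disk_val z) (f z)) ->
  forall n, coef f n = a n.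
Proof.
intros Ha; exact (pseries_coef_unique _ _ f (coef_pseries f) Ha).
Qed.

(** The real and imaginary parts are summed separately because [Series] is
    real-valued; for [f] and [g] in [H2] both series converge absolutely. *)
Definition Cseries (a : nat -> C) : C :=
  (Series (fun n => Re (a n)), Series (fun n => Im (a n))).

Definition inner (f g : H2) : C :=
  Cseries (fun n => Cmult (coef f n) (Cconj (coef g n))).

Definition H2_norm (f : H2) : R := sqrt (Re (inner f f)).

(** *** Vector space structure, pointwise *)

Lemma in_H2_plus (f g : H2) : in_H2 (fun z => Cplus (f z) (g z)).
Proof.
exists (fun n => Cplus (coef f n) (coef g n)); split.
- intros z; exact (is_pseries_plus _ _ _ _ _ (coef_pseries f z) (coef_pseries g z)).
- apply sq_summable_plus; apply coef_sq_summable.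
Qed.

Lemma in_H2_scal (k : C) (f : H2) : in_H2 (fun z => Cmult k (f z)).
Proof.
exists (fun n => Cmult k (coef f n)); split.
- intros z; exact (is_pseries_scal (K := C_AbsRing) (V := C_NormedModule) k _ _ _
                     (Cmult_comm _ _) (coef_pseries f z)).
- apply sq_summable_scal; apply coef_sq_summable.
Qed.

Lemma in_H2_zero : in_H2 (fun _ => RtoC 0).
Proof.
exists (fun _ => RtoC 0); split.
- intros z; unfold is_pseries.
  apply (is_series_ext (fun _ => @zero C_NormedModule)).
  + intros n; symmetry; exact (scal_zero_r (V := C_NormedModule) _).
  + unfold is_series; apply (filterlim_ext (fun _ => @zero C_NormedModule)).
    * intros n; induction n as [|n IH]; [rewrite sum_O; reflexivity|].
      rewrite sum_Sn, <- IH; symmetry; apply plus_zero_r.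
    * apply filterlim_const.
- exists 0; apply (is_series_ext (fun _ => 0)).
  + intros n; rewrite Cmod_0; symmetry; apply pow_i; lia.
  + unfold is_series; apply (filterlim_ext (fun _ => 0)).
    * intros n; rewrite sum_n_const; symmetry; apply Rmult_0_r.
    * apply filterlim_const.
Qed.

Definition H2_plus (f g : H2) : H2 := mkH2 _ (in_H2_plus f g).
Definition H2_scal (k : C) (f : H2) : H2 := mkH2 _ (in_H2_scal k f).
Definition H2_opp (f : H2) : H2 := H2_scal (RtoC (-1)) f.
Definition H2_zero : H2 := mkH2 _ in_H2_zero.

Lemma coef_plus (f g : H2) (n : nat) :
  coef (H2_plus f g) n = Cplus (coef f n) (coef g n).
Proof.
apply (coef_unique _ (fun n => Cplus (coef f n) (coef g n))).
intros z; exact (is_pseries_plus _ _ _ _ _ (coef_pseries f z) (coef_pseries g z)).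
Qed.

Lemma coef_scal (k : C) (f : H2) (n : nat) :
  coef (H2_scal k f) n = Cmult k (coef f n).
Proof.
apply (coef_unique _ (fun n => Cmult k (coef f n))).
intros z; exact (is_pseries_scal (K := C_AbsRing) (V := C_NormedModule) k _ _ _
                   (Cmult_comm _ _) (coef_pseries f z)).
Qed.

Ltac H2_pointwise :=
  intros; apply H2_ext; intros ?z; simpl;
  apply injective_projections; simpl; ring.

Lemma H2_plus_comm (f g : H2) : H2_plus f g = H2_plus g f.
Proof. H2_pointwise. Qed.

Lemma H2_plus_assoc (f g h : H2) :
  H2_plus f (H2_plus g h) = H2_plus (H2_plus f g) h.
Proof. H2_pointwise. Qed.

Lemma H2_plus_zero_r (f : H2) : H2_plus f H2_zero = f.
Proof. H2_pointwise. Qed.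

Lemma H2_plus_opp_r (f : H2) : H2_plus f (H2_opp f) = H2_zero.
Proof. H2_pointwise. Qed.

Definition H2_AbelianMonoid_mixin :=
  AbelianMonoid.Mixin H2 H2_plus H2_zero H2_plus_comm H2_plus_assoc H2_plus_zero_r.

Canonical H2_AbelianMonoid := AbelianMonoid.Pack H2 H2_AbelianMonoid_mixin H2.

Definition H2_AbelianGroup_mixin :=
  AbelianGroup.Mixin H2_AbelianMonoid H2_opp H2_plus_opp_r.

Canonical H2_AbelianGroup :=
  AbelianGroup.Pack H2 (AbelianGroup.Class _ _ H2_AbelianGroup_mixin) H2.

Lemma H2_scal_assoc (k l : C) (f : H2) :
  H2_scal k (H2_scal l f) = H2_scal (Cmult k l) f.
Proof. H2_pointwise. Qed.

Lemma H2_scal_one (f : H2) : H2_scal (RtoC 1) f = f.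
Proof. H2_pointwise. Qed.

Lemma H2_scal_distr_l (k : C) (f g : H2) :
  H2_scal k (H2_plus f g) = H2_plus (H2_scal k f) (H2_scal k g).
Proof. H2_pointwise. Qed.

Lemma H2_scal_distr_r (k l : C) (f : H2) :
  H2_scal (Cplus k l) f = H2_plus (H2_scal k f) (H2_scal l f).
Proof. H2_pointwise. Qed.

Definition H2_ModuleSpace_mixin :=
  ModuleSpace.Mixin C_Ring H2_AbelianGroup H2_scal
    H2_scal_assoc H2_scal_one H2_scal_distr_l H2_scal_distr_r.

Canonical H2_ModuleSpace :=
  ModuleSpace.Pack C_Ring H2 (ModuleSpace.Class _ _ _ H2_ModuleSpace_mixin) H2.

(** *** Norm structure *)

Lemma H2_normE (f : H2) : H2_norm f = sqrt (sq_sum (coef f)).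
Proof.
unfold H2_norm, inner, Cseries, sq_sum; f_equal; apply Series_ext; intros n.
rewrite <- Cmod2_conj; reflexivity.
Qed.

Lemma sq_sum_ext (a b : nat -> C) :
  (forall n, a n = b n) -> sq_sum a = sq_sum b.
Proof.
intros H; apply Series_ext; intros n; rewrite H; reflexivity.
Qed.

Lemma H2_norm_triangle (f g : H2) :
  H2_norm (H2_plus f g) <= H2_norm f + H2_norm g.
Proof.
rewrite !H2_normE, (sq_sum_ext _ _ (coef_plus f g)).
apply sq_sum_triangle; apply coef_sq_summable.
Qed.

Lemma H2_norm_scal (k : C) (f : H2) : H2_norm (H2_scal k f) = Cmod k * H2_norm f.
Proof.
rewrite !H2_normE, (sq_sum_ext _ _ (coef_scal k f)), sq_sum_scal.
rewrite sqrt_mult; [|apply pow2_ge_0|apply sq_sum_ge0, coef_sq_summable].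
rewrite sqrt_pow2 by apply Cmod_ge_0; reflexivity.
Qed.

Lemma H2_norm_eq0 (f : H2) : H2_norm f = 0 -> f = H2_zero.
Proof.
rewrite H2_normE; intros H.
apply sqrt_eq_0 in H; [|apply sq_sum_ge0, coef_sq_summable].
pose proof (sq_sum_eq0 _ (coef_sq_summable f) H) as Hc.
assert (E : f = H2_scal (RtoC 0) f).
{ apply H2_ext; intros z.
  apply (filterlim_locally_unique (F := eventually)
           (V := C_NormedModule)
           (fun N => sum_n (fun k => @scal C_AbsRing C_NormedModule
                       (@pow_n C_AbsRing (disk_val z) k) (coef f k)) N)).
  - exact (coef_pseries f z).
  - eapply filterlim_ext; [|exact (coef_pseries (H2_scal (RtoC 0) f) z)].
    intros N; apply sum_n_ext; intros n; rewrite coef_scal, Hc.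
    f_equal; exact (Cmult_0_r _). }
rewrite E; H2_pointwise.
Qed.

Definition H2_minus (f g : H2) : H2 := H2_plus f (H2_opp g).
Definition H2_ball (f : H2) (e : R) (g : H2) : Prop := H2_norm (H2_minus g f) < e.

Lemma H2_ball_center (f : H2) (e : posreal) : H2_ball f e f.
Proof.
unfold H2_ball.
replace (H2_minus f f) with (H2_scal (RtoC 0) f) by (unfold H2_minus; H2_pointwise).
rewrite H2_norm_scal, Cmod_0, Rmult_0_l; apply cond_pos.
Qed.

Lemma H2_ball_sym (f g : H2) (e : R) : H2_ball f e g -> H2_ball g e f.
Proof.
unfold H2_ball.
replace (H2_minus f g) with (H2_opp (H2_minus g f)) by (unfold H2_minus; H2_pointwise).
unfold H2_opp; rewrite H2_norm_scal, Cmod_R, (Rabs_left (-1)) by lra.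
replace (- -1 * H2_norm (H2_minus g f)) with (H2_norm (H2_minus g f)) by ring.
exact (fun h => h).
Qed.

Lemma H2_ball_triangle (f g h : H2) (e1 e2 : R) :
  H2_ball f e1 g -> H2_ball g e2 h -> H2_ball f (e1 + e2) h.
Proof.
unfold H2_ball; intros H1 H2.
replace (H2_minus h f) with (H2_plus (H2_minus g f) (H2_minus h g))
  by (unfold H2_minus; H2_pointwise).
pose proof (H2_norm_triangle (H2_minus g f) (H2_minus h g)); lra.
Qed.

Definition H2_UniformSpace_mixin :=
  UniformSpace.Mixin H2 H2_zero H2_ball H2_ball_center H2_ball_sym H2_ball_triangle.

Canonical H2_UniformSpace := UniformSpace.Pack H2 H2_UniformSpace_mixin H2.

Canonical H2_NormedModuleAux :=
  NormedModuleAux.Pack C_AbsRing H2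
    (NormedModuleAux.Class C_AbsRing H2
       (ModuleSpace.class C_Ring H2_ModuleSpace) H2_UniformSpace_mixin) H2.

Lemma H2_norm_compat (f g : H2) (e : posreal) :
  H2_ball f e g -> H2_norm (H2_minus g f) < 1 * e.
Proof. rewrite Rmult_1_l; exact (fun h => h). Qed.

Definition H2_NormedModule_mixin :=
  NormedModule.Mixin C_AbsRing H2_NormedModuleAux H2_norm 1
    H2_norm_triangle (fun k f => Req_le _ _ (H2_norm_scal k f))
    (fun _ _ _ h => h) H2_norm_compat H2_norm_eq0.

Canonical H2_NormedModule :=
  NormedModule.Pack C_AbsRing H2
    (NormedModule.Class _ _ _ H2_NormedModule_mixin) H2.

(** ** Operators on the Hardy space *)

Definition bounded_operator (T : H2 -> H2) : Prop :=
  @is_linear C_AbsRing H2_NormedModule H2_NormedModule T.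

Definition is_adjoint (T S : H2 -> H2) : Prop :=
  bounded_operator S /\ forall f g : H2, inner (T f) g = inner f (S g).

Definition conjugation (J : H2 -> H2) : Prop :=
  (forall f g : H2, J (H2_plus f g) = H2_plus (J f) (J g)) /\
  (forall (k : C) (f : H2), J (H2_scal k f) = H2_scal (Cconj k) (J f)) /\
  (forall f g : H2, inner (J f) (J g) = inner g f) /\
  (forall f : H2, J (J f) = f).

Definition complex_symmetric (T : H2 -> H2) : Prop :=
  bounded_operator T /\
  exists J S : H2 -> H2,
    conjugation J /\ is_adjoint T S /\ forall f : H2, J (T f) = S (J f).

(** By Littlewood's subordination theorem every analytic self-map [phi] of the
    disk has a composition operator on [H2]; it is unique by [H2_ext]. *)
Definition is_composition_operator (phi : disk -> disk) (T : H2 -> H2) : Prop :=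
  forall (f : H2) (z : disk), T f z = f (phi z).

Definition in_commutant (T A : H2 -> H2) : Prop :=
  bounded_operator A /\ forall f : H2, A (T f) = T (A f).

(* Main.v *)
From Stdlib Require Import Reals Lra Lia.
From Stdlib Require Import FunctionalExtensionality ProofIrrelevance Classical.
From Coquelicot Require Import Coquelicot.
Require Import Defs.

Local Open Scope R_scope.

(** Let [a] be the fixed point, [l] the multiplier, [J] the conjugation, [S] the
    adjoint of the composition operator [T].  Everything happens for the bilinear
    form [[f, g] = <f, J g>]: it is symmetric because [J] is a conjugation, and an
    operator [A] satisfies [J A = A* J] exactly when [[A f, g] = [f, A g]].

    The form makes [T] symmetric, so eigenvectors of [T] for different eigenvalues
    are orthogonal for it.  Each eigenvalue [l ^ n] of [T] has multiplicity at most
    one ([eigenspace_dim1]): comparing Taylor expansions at [a], an eigenfunction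
    whose [n]-th coefficient vanishes has all coefficients equal to [0].  Hence [A],
    which commutes with [T], acts on every such eigenvector by a scalar, and
    [[A u, u'] = [u, A u']] holds for all eigenvectors [u], [u'] of [T] with
    eigenvalues powers of [l].  It remains to see that these eigenvectors are total.

    They are the [J v], where [v] runs through the eigenvectors of [S] for the powers
    of [Cconj l], so it is enough that the latter are total.  The Taylor coefficients
    at [a] are bounded functionals, and [T] acts on them by a triangular matrix with
    diagonal [1, l, l ^ 2, ...].  The vectors that represent the first [n]
    coefficients therefore span a finite-dimensional space on which [S] is
    triangular with distinct diagonal entries, hence diagonalizable
    ([annihilator_eigen_span]).  A function orthogonal to all of them has zero
    Taylor series at [a] and is [0] by the identity theorem.

    Taylor expansions at [a] come from the reproducing kernels [K_z], by iterating
    [K_z = K_a + Cconj (z - a) E K_z] with a bounded operator [E].  The symbol [phi]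
    is expanded in the same way, because it is the image of the identity function
    under [T] and so belongs to the Hardy space.  Passing from total families to all
    of [H2] uses the Riesz representation of [f |-> <A f, g>]; the adjoint of [A] is
    then [J A J]. *)

(** * Hilbert space structure *)

Lemma is_series_C (a : nat -> C) (l : C) :
  @is_series C_AbsRing C_NormedModule a l <->
  is_series (fun n => Re (a n)) (Re l) /\ is_series (fun n => Im (a n)) (Im l).
Proof.
assert (E : forall N, sum_n (G := C_NormedModule) a N
  = (sum_n (fun k => Re (a k)) N, sum_n (fun k => Im (a k)) N) :> C).
{ induction N as [|N IH].
  - rewrite !sum_O; destruct (a 0%nat); reflexivity.
  - rewrite !sum_Sn, IH; reflexivity. }
unfold is_series; split.
- intros H; split; apply filterlim_locally; intros eps;
    generalize (proj1 (filterlim_locally _ _) H eps); apply filter_imp;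
    intros N HN; rewrite E in HN; apply HN.
- intros [H1 H2]; apply filterlim_locally; intros eps.
  generalize (filter_and _ _ (proj1 (filterlim_locally _ _) H1 eps)
                (proj1 (filterlim_locally _ _) H2 eps)).
  apply filter_imp; intros N HN; rewrite E; exact HN.
Qed.

Lemma C_eq_of_close (x y : C) :
  (forall e, 0 < e -> Cmod (x - y)%C <= e) -> x = y.
Proof.
intros H.
assert (Z : (x - y)%C = RtoC 0).
{ apply Cmod_eq_0, Rle_antisym; [|apply Cmod_ge_0].
  apply le_epsilon; intros e He; rewrite Rplus_0_l; exact (H e He). }
replace x with ((x - y) + y)%C by ring; rewrite Z; ring.
Qed.

Lemma im_le_Cmod (c : C) : Rabs (Im c) <= Cmod c.
Proof. apply Rle_trans with (2 := Rmax_Cmod c); apply Rmax_r. Qed.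

Lemma ex_series_Cmod_le (a : nat -> C) (b : nat -> R) :
  (forall n, Cmod (a n) <= b n) -> ex_series b ->
  ex_series (fun n => Re (a n)) /\ ex_series (fun n => Im (a n)).
Proof.
intros H Hb; split;
  apply (ex_series_le (V := R_CompleteNormedModule) _ b); try exact Hb;
  intros n; apply Rle_trans with (2 := H n); [apply re_le_Cmod|apply im_le_Cmod].
Qed.

Lemma ex_series_mul_sq_summable (a b : nat -> C) :
  sq_summable a -> sq_summable b ->
  ex_series (fun n => Re (a n * b n)%C) /\ ex_series (fun n => Im (a n * b n)%C).
Proof.
intros Ha Hb.
apply (ex_series_Cmod_le _ (fun n => Cmod (a n) ^ 2 + Cmod (b n) ^ 2)).
- intros n; rewrite Cmod_mult.
  pose proof (pow2_ge_0 (Cmod (a n) - Cmod (b n))).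
  pose proof (pow2_ge_0 (Cmod (a n))); pose proof (pow2_ge_0 (Cmod (b n))); nra.
- exact (ex_series_plus _ _ Ha Hb).
Qed.

Lemma sq_summable_conj (a : nat -> C) :
  sq_summable a -> sq_summable (fun n => Cconj (a n)).
Proof.
intros Ha; apply (ex_series_ext (fun n => Cmod (a n) ^ 2)); [|exact Ha].
intros n; rewrite Cmod_conj; reflexivity.
Qed.

Lemma Cseries_correct (a : nat -> C) :
  ex_series (fun n => Re (a n)) -> ex_series (fun n => Im (a n)) ->
  @is_series C_AbsRing C_NormedModule a (Cseries a).
Proof.
intros H1 H2; apply is_series_C; split; apply Series_correct; assumption.
Qed.

Lemma Cseries_unique (a : nat -> C) (l : C) :
  @is_series C_AbsRing C_NormedModule a l -> Cseries a = l.
Proof.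
intros H; apply is_series_C in H; destruct H as [H1 H2].
apply injective_projections; apply is_series_unique; assumption.
Qed.

Lemma is_series_inner (f g : H2) :
  @is_series C_AbsRing C_NormedModule
    (fun n => coef f n * Cconj (coef g n))%C (inner f g).
Proof.
destruct (ex_series_mul_sq_summable _ _ (coef_sq_summable f)
            (sq_summable_conj _ (coef_sq_summable g))) as [H1 H2].
apply Cseries_correct; assumption.
Qed.

Lemma sq_summable_kernel (z : disk) : sq_summable (fun n => Cconj (z ^ n)%C).
Proof.
exists (/ (1 - Cmod z ^ 2)).
apply (is_series_ext (fun n => (Cmod z ^ 2) ^ n)).
- intros n; rewrite Cmod_conj, Cmod_pow, <- !pow_mult, Nat.mul_comm; reflexivity.
- apply is_series_geom.
  pose proof (disk_lt z); pose proof (Cmod_ge_0 z).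
  rewrite Rabs_pos_eq by apply pow2_ge_0; nra.
Qed.

Lemma pow_n_Cpow (z : C) (n : nat) : @pow_n C_AbsRing z n = (z ^ n)%C.
Proof.
induction n as [|n IH]; [reflexivity|].
change (Cmult z (@pow_n C_AbsRing z n) = Cmult z (z ^ n)%C); rewrite IH; reflexivity.
Qed.

Lemma is_pseries_series (a : nat -> C) (z l : C) :
  @is_pseries C_AbsRing C_NormedModule a z l <->
  @is_series C_AbsRing C_NormedModule (fun n => a n * z ^ n)%C l.
Proof.
assert (E : forall n, @scal C_AbsRing C_NormedModule (@pow_n C_AbsRing z n) (a n)
  = (a n * z ^ n)%C).
{ intros n; rewrite pow_n_Cpow; exact (Cmult_comm _ _). }
unfold is_pseries; split; apply is_series_ext; intros n; [|symmetry]; apply E.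
Qed.

Lemma is_pseries_of_seq (a : nat -> C) (z : disk) :
  sq_summable a ->
  @is_pseries C_AbsRing C_NormedModule a (disk_val z)
    (Cseries (fun n => a n * z ^ n)%C).
Proof.
intros Ha; apply is_pseries_series.
destruct (ex_series_mul_sq_summable a (fun n => z ^ n)%C Ha) as [H1 H2].
- apply (ex_series_ext (fun n => Cmod (Cconj (z ^ n)%C) ^ 2)).
  + intros n; rewrite Cmod_conj; reflexivity.
  + apply sq_summable_kernel.
- apply Cseries_correct; assumption.
Qed.

Lemma in_H2_of_seq (a : nat -> C) :
  sq_summable a -> in_H2 (fun z => Cseries (fun n => a n * z ^ n)%C).
Proof.
intros Ha; exists a; split; [|exact Ha].
intros z; apply is_pseries_of_seq, Ha.
Qed.

Definition of_seq (a : nat -> C) (Ha : sq_summable a) : H2 :=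
  mkH2 _ (in_H2_of_seq a Ha).

Lemma coef_of_seq (a : nat -> C) (Ha : sq_summable a) (n : nat) :
  coef (of_seq a Ha) n = a n.
Proof.
apply (coef_unique (of_seq a Ha)); intros z; apply is_pseries_of_seq, Ha.
Qed.

Definition kernel (z : disk) : H2 := of_seq _ (sq_summable_kernel z).

Lemma coef_kernel (z : disk) (n : nat) : coef (kernel z) n = Cconj (z ^ n)%C.
Proof. apply (coef_of_seq _ (sq_summable_kernel z)). Qed.

(** Point evaluations are bounded functionals: this turns every statement about
    values into one about inner products. *)
Lemma inner_kernel (f : H2) (z : disk) : inner f (kernel z) = f z.
Proof.
apply Cseries_unique.
apply (is_series_ext (fun n => coef f n * z ^ n)%C).
- intros n; rewrite coef_kernel, Cconj_conj; reflexivity.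
- apply is_pseries_series, coef_pseries.
Qed.

Lemma H2_coef_ext (f g : H2) : (forall n, coef f n = coef g n) -> f = g.
Proof.
intros H; apply H2_ext; intros z.
rewrite <- !inner_kernel; unfold inner.
assert (E : (fun n => coef f n * Cconj (coef (kernel z) n))%C
          = (fun n => coef g n * Cconj (coef (kernel z) n))%C).
{ apply functional_extensionality; intros n; rewrite H; reflexivity. }
rewrite E; reflexivity.
Qed.

Lemma inner_plus_l (f g h : H2) :
  inner (H2_plus f g) h = (inner f h + inner g h)%C.
Proof.
apply Cseries_unique.
eapply is_series_ext;
  [|exact (is_series_plus _ _ _ _ (is_series_inner f h) (is_series_inner g h))].
intros n; rewrite coef_plus; unfold plus; simpl; ring.
Qed.

Lemma inner_scal_l (k : C) (f g : H2) :
  inner (H2_scal k f) g = (k * inner f g)%C.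
Proof.
apply Cseries_unique.
eapply is_series_ext; [|exact (is_series_scal k _ _ (is_series_inner f g))].
intros n; rewrite coef_scal; unfold scal; simpl; unfold mult; simpl; ring.
Qed.

Lemma inner_conj (f g : H2) : Cconj (inner f g) = inner g f.
Proof.
pose proof (is_series_inner f g) as H; apply is_series_C in H; destruct H as [H1 H2].
symmetry; apply Cseries_unique, is_series_C; split.
- rewrite re_conj; eapply is_series_ext; [|exact H1].
  intros n; simpl; ring.
- rewrite im_conj; eapply is_series_ext; [|exact (is_series_opp _ _ H2)].
  intros n; unfold opp; simpl; ring.
Qed.

Lemma inner_plus_r (f g h : H2) :
  inner f (H2_plus g h) = (inner f g + inner f h)%C.
Proof.
rewrite <- !(inner_conj _ f), inner_plus_l, Cplus_conj; reflexivity.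
Qed.

Lemma inner_scal_r (k : C) (f g : H2) :
  inner f (H2_scal k g) = (Cconj k * inner f g)%C.
Proof.
rewrite <- !(inner_conj _ f), inner_scal_l, Cmult_conj; reflexivity.
Qed.

Lemma inner_zero_l (f : H2) : inner H2_zero f = RtoC 0.
Proof.
replace H2_zero with (H2_scal (RtoC 0) f) by (apply H2_ext; intros z; simpl; ring).
rewrite inner_scal_l; ring.
Qed.

Lemma inner_zero_r (f : H2) : inner f H2_zero = RtoC 0.
Proof.
rewrite <- inner_conj, inner_zero_l; apply injective_projections; simpl; ring.
Qed.

Lemma RtoC_m1 : RtoC (-1) = (- (1))%C.
Proof. apply injective_projections; simpl; ring. Qed.

Lemma inner_minus_l (f g h : H2) :
  inner (H2_minus f g) h = (inner f h - inner g h)%C.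
Proof.
unfold H2_minus, H2_opp; rewrite inner_plus_l, inner_scal_l.
rewrite RtoC_m1; ring.
Qed.

Lemma inner_minus_r (f g h : H2) :
  inner f (H2_minus g h) = (inner f g - inner f h)%C.
Proof.
rewrite <- !(inner_conj _ f), inner_minus_l, Cminus_conj; reflexivity.
Qed.

Lemma H2_norm_ge0 (f : H2) : 0 <= H2_norm f.
Proof. apply sqrt_pos. Qed.

Lemma H2_norm_sq (f : H2) : H2_norm f ^ 2 = sq_sum (coef f).
Proof.
rewrite H2_normE, pow2_sqrt; [reflexivity|apply sq_sum_ge0, coef_sq_summable].
Qed.

Lemma inner_self (f : H2) : inner f f = RtoC (H2_norm f ^ 2).
Proof.
apply Cseries_unique.
apply (is_series_ext (fun n => RtoC (Cmod (coef f n) ^ 2))).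
{ intros n; apply Cmod2_conj. }
rewrite H2_norm_sq; apply is_series_C; split.
- exact (Series_correct _ (coef_sq_summable f)).
- apply (is_series_ext (fun n => 0 * Cmod (coef f n) ^ 2)).
  + intros n; simpl; ring.
  + replace (Im _) with (0 * sq_sum (coef f)) by (simpl; ring).
    exact (is_series_scal_l (K := R_AbsRing) 0 _ _
             (Series_correct _ (coef_sq_summable f))).
Qed.

Lemma inner_self_eq0 (f : H2) : inner f f = RtoC 0 -> f = H2_zero.
Proof.
intros H; apply H2_norm_eq0.
rewrite inner_self in H; apply RtoC_inj in H.
pose proof (H2_norm_ge0 f); nra.
Qed.

Lemma H2_minus_eq0 (f g : H2) : H2_minus f g = H2_zero -> f = g.
Proof.
intros H; apply H2_ext; intros z.
assert (E : H2_minus f g z = H2_zero z) by (rewrite H; reflexivity).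
simpl in E.
replace (f z) with ((f z + -1 * g z) + g z)%C by (rewrite RtoC_m1; ring).
rewrite E; ring.
Qed.

Lemma cauchy_schwarz (f g : H2) : Cmod (inner f g) <= H2_norm f * H2_norm g.
Proof.
pose proof (H2_norm_ge0 f) as Pf; pose proof (H2_norm_ge0 g) as Pg.
destruct (Req_dec (H2_norm g) 0) as [H0|H0].
{ rewrite H0, (H2_norm_eq0 g H0), inner_zero_r, Cmod_0; lra. }
set (b := H2_norm g) in *.
(* the squared norm of [b^2 f - <f,g> g] is [b^2 (b^2 |f|^2 - |<f,g>|^2)] *)
set (h := H2_minus (H2_scal (RtoC (b ^ 2)) f) (H2_scal (inner f g) g)).
assert (E : inner h h = RtoC (b ^ 2 * (b ^ 2 * H2_norm f ^ 2 - Cmod (inner f g) ^ 2))).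
{ unfold h; rewrite inner_minus_l, !inner_minus_r, !inner_scal_l, !inner_scal_r.
  rewrite !inner_self, <- (inner_conj f g); fold b.
  rewrite RtoC_mult, RtoC_minus, RtoC_mult, Cmod2_conj.
  replace (Cconj (RtoC (b ^ 2))) with (RtoC (b ^ 2))
    by (apply injective_projections; simpl; ring).
  ring. }
rewrite inner_self in E; apply RtoC_inj in E.
pose proof (pow2_ge_0 (H2_norm h)).
pose proof (Cmod_ge_0 (inner f g)).
assert (0 < b) by lra.
assert (0 < b ^ 2) by (apply pow_lt; lra).
apply Rnot_lt_le; intros Hlt.
pose proof (Rmult_le_pos _ _ Pf Pg) as P.
assert (K : (H2_norm f * b) ^ 2 < Cmod (inner f g) ^ 2) by nra.
rewrite Rpow_mult_distr in K; nra.
Qed.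

(** * Polynomials and the Riesz representation theorem *)

Lemma is_series_single (a : nat -> C) (j : nat) :
  (forall n, n <> j -> a n = RtoC 0) ->
  @is_series C_AbsRing C_NormedModule a (a j).
Proof.
intros H.
apply (filterlim_ext_loc (fun _ => a j)); [|apply filterlim_const].
assert (L : forall N, (N < j)%nat -> sum_n (G := C_NormedModule) a N = RtoC 0).
{ induction N as [|N IH]; intros HN.
  - rewrite sum_O; apply H; lia.
  - rewrite sum_Sn, IH, H by lia; exact (Cplus_0_r _). }
exists j; intros N HN; induction HN as [|N HN IH].
- destruct j as [|j]; [rewrite sum_O; reflexivity|].
  rewrite sum_Sn, L by lia; symmetry; exact (Cplus_0_l _).
- rewrite sum_Sn, <- IH, (H (S N)) by lia; symmetry; exact (Cplus_0_r _).
Qed.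

Lemma sq_summable_bounded (a : nat -> C) (B : R) :
  (forall N, sum_n (fun n => Cmod (a n) ^ 2) N <= B) -> sq_summable a.
Proof.
intros H.
destruct (ex_finite_lim_seq_incr (sum_n (fun n => Cmod (a n) ^ 2)) B) as [l Hl].
- intros N; rewrite sum_Sn; change plus with Rplus.
  pose proof (pow2_ge_0 (Cmod (a (S N)))); lra.
- exact H.
- exists l; exact Hl.
Qed.

Lemma sq_summable_monomial (j : nat) :
  sq_summable (fun n => if Nat.eqb n j then RtoC 1 else RtoC 0).
Proof.
apply (sq_summable_bounded _ 1); intros N.
set (x := fun n => Cmod (if Nat.eqb n j then RtoC 1 else RtoC 0) ^ 2).
assert (X : forall n, x n = if Nat.eqb n j then 1 else 0).
{ intros n; unfold x; destruct (Nat.eqb n j); [rewrite Cmod_1|rewrite Cmod_0]; ring. }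
assert (K : sum_n x N <= if Nat.leb j N then 1 else 0).
{ induction N as [|N IH].
  - rewrite sum_O, X; destruct j; simpl; lra.
  - rewrite sum_Sn, X; change plus with Rplus.
    destruct (Nat.leb_spec j N), (Nat.leb_spec j (S N)), (Nat.eqb_spec (S N) j);
      try lia; lra. }
destruct (Nat.leb j N); lra.
Qed.

Definition monomial (j : nat) : H2 := of_seq _ (sq_summable_monomial j).

Lemma coef_monomial (j n : nat) :
  coef (monomial j) n = if Nat.eqb n j then RtoC 1 else RtoC 0.
Proof. apply (coef_of_seq _ (sq_summable_monomial j)). Qed.

Lemma inner_monomial_r (f : H2) (j : nat) : inner f (monomial j) = coef f j.
Proof.
set (a := fun n => (coef f n * Cconj (coef (monomial j) n))%C).
replace (coef f j) with (a j).
- apply Cseries_unique, is_series_single; intros n Hn; unfold a.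
  rewrite coef_monomial; destruct (Nat.eqb_spec n j); [contradiction|].
  apply injective_projections; simpl; ring.
- unfold a; rewrite coef_monomial, Nat.eqb_refl.
  apply injective_projections; simpl; ring.
Qed.

Lemma monomial_1 (z : disk) : monomial 1 z = disk_val z.
Proof.
rewrite <- inner_kernel, <- inner_conj, inner_monomial_r, coef_kernel, Cconj_conj.
apply Cpow_1_r.
Qed.

Fixpoint truncation (b : nat -> C) (N : nat) : H2 :=
  match N with
  | O => H2_zero
  | S N => H2_plus (truncation b N) (H2_scal (b N) (monomial N))
  end.

Lemma coef_zero (n : nat) : coef H2_zero n = RtoC 0.
Proof. rewrite <- inner_monomial_r; apply inner_zero_l. Qed.

Lemma coef_truncation (b : nat -> C) (N n : nat) :
  coef (truncation b N) n = if Nat.ltb n N then b n else RtoC 0.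
Proof.
induction N as [|N IH]; simpl truncation.
- apply coef_zero.
- rewrite coef_plus, coef_scal, coef_monomial, IH.
  destruct (Nat.ltb_spec n N), (Nat.ltb_spec n (S N)), (Nat.eqb_spec n N);
    try lia; subst; ring.
Qed.

Lemma inner_truncation_eq0 (f : H2) (b : nat -> C) (N : nat) :
  (forall n, (n < N)%nat -> coef f n = RtoC 0) -> inner f (truncation b N) = RtoC 0.
Proof.
intros H; induction N as [|N IH]; simpl truncation; [apply inner_zero_r|].
rewrite inner_plus_r, inner_scal_r, inner_monomial_r, H, IH by auto; ring.
Qed.

Lemma pythagoras (f g : H2) :
  inner f g = RtoC 0 -> H2_norm (H2_plus f g) ^ 2 = H2_norm f ^ 2 + H2_norm g ^ 2.
Proof.
intros H; apply RtoC_inj.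
rewrite RtoC_plus, <- !inner_self, inner_plus_l, !inner_plus_r.
rewrite <- (inner_conj f g), H; apply injective_projections; simpl; ring.
Qed.

Lemma norm_monomial (j : nat) : H2_norm (monomial j) = 1.
Proof.
pose proof (H2_norm_ge0 (monomial j)).
assert (E : RtoC (H2_norm (monomial j) ^ 2) = RtoC 1).
{ rewrite <- inner_self, inner_monomial_r, coef_monomial, Nat.eqb_refl; reflexivity. }
apply RtoC_inj in E; nra.
Qed.

Lemma norm_truncation_S (b : nat -> C) (N : nat) :
  H2_norm (truncation b (S N)) ^ 2
  = H2_norm (truncation b N) ^ 2 + Cmod (b N) ^ 2.
Proof.
simpl truncation; rewrite pythagoras.
- rewrite H2_norm_scal, norm_monomial; ring.
- rewrite inner_scal_r, inner_monomial_r, coef_truncation, Nat.ltb_irrefl; ring.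
Qed.

Lemma norm_zero : H2_norm H2_zero = 0.
Proof.
pose proof (inner_self H2_zero) as E; rewrite inner_zero_l in E.
apply RtoC_inj in E; nra.
Qed.

Lemma norm_truncation (b : nat -> C) (N : nat) :
  H2_norm (truncation b (S N)) ^ 2 = sum_n (fun n => Cmod (b n) ^ 2) N.
Proof.
induction N as [|N IH].
- rewrite norm_truncation_S, sum_O; simpl truncation; rewrite norm_zero; ring.
- rewrite norm_truncation_S, IH, sum_Sn; reflexivity.
Qed.

Lemma truncation_approx (f : H2) (e : R) :
  0 < e -> exists N, H2_norm (H2_minus f (truncation (coef f) N)) < e.
Proof.
intros He.
assert (He2 : 0 < e ^ 2) by (apply pow_lt; exact He).
pose proof (Series_correct _ (coef_sq_summable f)) as L.
destruct (proj1 (filterlim_locally _ _) L (mkposreal _ He2)) as [N L'].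
clear L; rename L' into L; specialize (L N (le_n N)).
exists (S N).
set (t := truncation (coef f) (S N)).
assert (E : f = H2_plus (H2_minus f t) t).
{ apply H2_ext; intros z; simpl; rewrite RtoC_m1; ring. }
assert (P : H2_norm f ^ 2 = H2_norm (H2_minus f t) ^ 2 + H2_norm t ^ 2).
{ rewrite E at 1; apply pythagoras; unfold t; apply inner_truncation_eq0.
  intros n Hn; rewrite <- inner_monomial_r, inner_minus_l, !inner_monomial_r.
  rewrite coef_truncation; destruct (Nat.ltb_spec n (S N)); [ring|lia]. }
rewrite (H2_norm_sq f) in P; unfold t in P at 2; rewrite norm_truncation in P.
change (Rabs (sum_n (fun n => Cmod (coef f n) ^ 2) N - sq_sum (coef f)) < e ^ 2) in L.
apply Rabs_def2 in L; pose proof (H2_norm_ge0 (H2_minus f t)); nra.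
Qed.

(** The partial sums of the candidate [r] have norm at most [|M|], because [l] takes
    the value [|p|^2] on the partial sum [p]; so [r] is in [H2], and [l] agrees with
    [<., r>] on polynomials, which are dense. *)
Lemma riesz (l : H2 -> C) (M : R) :
  (forall f g, l (H2_plus f g) = (l f + l g)%C) ->
  (forall k f, l (H2_scal k f) = (k * l f)%C) ->
  (forall f, Cmod (l f) <= M * H2_norm f) ->
  exists r : H2, forall f, l f = inner f r.
Proof.
intros Hp Hs Hb.
assert (H0 : l H2_zero = RtoC 0).
{ replace H2_zero with (H2_scal (RtoC 0) H2_zero)
    by (apply H2_ext; intros z; simpl; ring).
  rewrite Hs; ring. }
set (b := fun n => Cconj (l (monomial n))).
assert (T : forall N, l (truncation b N) = RtoC (H2_norm (truncation b N) ^ 2)).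
{ induction N as [|N IH].
  - simpl truncation; rewrite H0, norm_zero; apply injective_projections; simpl; ring.
  - rewrite norm_truncation_S, RtoC_plus, <- IH; simpl truncation; rewrite Hp, Hs.
    unfold b at 2 4; rewrite Cmod_conj, Cmod2_conj; ring. }
assert (B : forall N, H2_norm (truncation b N) <= Rabs M).
{ intros N; pose proof (Hb (truncation b N)) as K; rewrite T, Cmod_R in K.
  pose proof (H2_norm_ge0 (truncation b N)); pose proof (Rle_abs M).
  pose proof (Rabs_pos M).
  rewrite Rabs_pos_eq in K by apply pow2_ge_0; nra. }
assert (Sb : sq_summable b).
{ apply (sq_summable_bounded _ (Rabs M ^ 2)); intros N.
  rewrite <- norm_truncation; apply pow_incr; split; [apply H2_norm_ge0|apply B]. }
exists (of_seq b Sb); intros f; set (r := of_seq b Sb).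
assert (E : forall c N, l (truncation c N) = inner (truncation c N) r).
{ intros c; induction N as [|N IH]; simpl truncation.
  - rewrite inner_zero_l; exact H0.
  - rewrite Hp, Hs, inner_plus_l, inner_scal_l, IH, <- (inner_conj r (monomial N)).
    rewrite inner_monomial_r; unfold r; rewrite coef_of_seq; unfold b at 3.
    rewrite Cconj_conj; reflexivity. }
apply C_eq_of_close; intros e He.
pose proof (H2_norm_ge0 r) as Pr; pose proof (Rabs_pos M) as PM.
set (K := Rabs M + H2_norm r + 1).
assert (PK : 0 < K) by (unfold K; lra).
destruct (truncation_approx f (e / K)) as [N HN]; [apply Rdiv_lt_0_compat; lra|].
set (t := truncation (coef f) N) in *; set (d := H2_minus f t) in *.
replace (l f - inner f r)%C with (l d - inner d r)%C.
- apply Rle_trans with (K * H2_norm d).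
  + apply Rle_trans with (Cmod (l d) + Cmod (- inner d r)%C);
      [apply Cmod_triangle|rewrite Cmod_opp].
    pose proof (Hb d); pose proof (cauchy_schwarz d r); pose proof (H2_norm_ge0 d).
    pose proof (Rle_abs M); unfold K; nra.
  + apply Rlt_le; apply (Rmult_lt_compat_l K) in HN; [|exact PK].
    replace (K * (e / K)) with e in HN by (field; lra); exact HN.
- replace f with (H2_plus d t)
    by (apply H2_ext; intros z; simpl; rewrite RtoC_m1; ring).
  rewrite Hp, inner_plus_l; unfold t; rewrite E; ring.
Qed.

(** * Taylor expansion at a point of the disk *)

(** The coefficients of [w |-> w g(w) / (1 - Cconj a w)]. *)
Fixpoint diff_quot_adj_seq (a : C) (g : nat -> C) (n : nat) : C :=
  match n with
  | O => RtoC 0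
  | S n => (g n + Cconj a * diff_quot_adj_seq a g n)%C
  end.

Lemma sum_n_le_sq_sum (a : nat -> C) (N : nat) :
  sq_summable a -> sum_n (fun n => Cmod (a n) ^ 2) N <= sq_sum a.
Proof.
intros Ha.
apply (is_lim_seq_incr_compare (sum_n (fun n => Cmod (a n) ^ 2)) (sq_sum a)).
- exact (Series_correct _ Ha).
- intros m; rewrite sum_Sn; change plus with Rplus.
  pose proof (pow2_ge_0 (Cmod (a (S m)))); lra.
Qed.

Lemma sq_sum_le (a : nat -> C) (B : R) :
  sq_summable a -> (forall N, sum_n (fun n => Cmod (a n) ^ 2) N <= B) ->
  sq_sum a <= B.
Proof.
intros Ha H.
exact (is_lim_seq_le _ (fun _ => B) (Finite (sq_sum a)) (Finite B) H
         (Series_correct _ Ha) (is_lim_seq_const B)).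
Qed.

(** The recursion [e (n+1) = g n + Cconj a * e n] bounds the [l^2] norm [x] of [e] by
    [x <= |g| + |a| x]; the proof is this inequality for partial sums of squares. *)
Lemma diff_quot_adj_seq_bound (a : disk) (g : H2) (N : nat) :
  sum_n (fun n => Cmod (diff_quot_adj_seq a (coef g) n) ^ 2) N
  <= (H2_norm g / (1 - Cmod a)) ^ 2.
Proof.
pose proof (disk_lt a) as Ha; pose proof (Cmod_ge_0 a) as Ha0.
set (r := Cmod a) in *; set (e := diff_quot_adj_seq a (coef g)).
set (X := sum_n (fun n => Cmod (e n) ^ 2)).
set (G := sum_n (fun n => Cmod (coef g n) ^ 2)).
(* convexity of the square: [x + r y = (1 - r) (x / (1 - r)) + r y] *)
assert (S1 : forall n, Cmod (e (S n)) ^ 2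
  <= Cmod (coef g n) ^ 2 / (1 - r) + r * Cmod (e n) ^ 2).
{ intros n; change (e (S n)) with (coef g n + Cconj a * e n)%C.
  pose proof (Cmod_triangle (coef g n) (Cconj a * e n)%C) as T.
  rewrite Cmod_mult, Cmod_conj in T; fold r in T.
  set (x := Cmod (coef g n)) in *; set (y := Cmod (e n)) in *.
  apply Rle_trans with ((x + r * y) ^ 2).
  - apply pow_incr; split; [apply Cmod_ge_0|exact T].
  - assert (0 <= r / (1 - r) * (x - (1 - r) * y) ^ 2).
    { apply Rmult_le_pos; [apply Rdiv_le_0_compat; lra|apply pow2_ge_0]. }
    replace (r / (1 - r) * (x - (1 - r) * y) ^ 2)
      with (x ^ 2 / (1 - r) + r * y ^ 2 - (x + r * y) ^ 2) in H by (field; lra).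
    lra. }
assert (S2 : forall n, X (S n) <= G n / (1 - r) + r * X n).
{ induction n as [|n IH].
  - unfold X, G; rewrite sum_Sn, !sum_O; change plus with Rplus.
    specialize (S1 0%nat); change (e 0%nat) with (RtoC 0) in *.
    rewrite Cmod_0 in *; lra.
  - replace (X (S (S n))) with (X (S n) + Cmod (e (S (S n))) ^ 2)
      by (unfold X; rewrite (sum_Sn _ (S n)); reflexivity).
    replace (X (S n)) with (X n + Cmod (e (S n)) ^ 2) at 2
      by (unfold X; rewrite (sum_Sn _ n); reflexivity).
    replace (G (S n)) with (G n + Cmod (coef g (S n)) ^ 2)
      by (unfold G; rewrite (sum_Sn _ n); reflexivity).
    specialize (S1 (S n)).
    replace ((G n + Cmod (coef g (S n)) ^ 2) / (1 - r))
      with (G n / (1 - r) + Cmod (coef g (S n)) ^ 2 / (1 - r)) by (field; lra).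
    lra. }
assert (HG : forall n, G n <= H2_norm g ^ 2).
{ intros n; rewrite H2_norm_sq; apply sum_n_le_sq_sum, coef_sq_summable. }
change (X N <= (H2_norm g / (1 - r)) ^ 2).
set (B := (H2_norm g / (1 - r)) ^ 2).
assert (EB : B = H2_norm g ^ 2 / (1 - r) + r * B) by (unfold B; field; lra).
induction N as [|N IH].
- unfold X; rewrite sum_O; change (e 0%nat) with (RtoC 0); rewrite Cmod_0.
  replace (0 ^ 2) with 0 by ring; apply pow2_ge_0.
- apply Rle_trans with (1 := S2 N); rewrite EB.
  apply Rplus_le_compat; [|apply Rmult_le_compat_l; lra].
  apply Rmult_le_compat_r; [apply Rlt_le, Rinv_0_lt_compat; lra|apply HG].
Qed.

Lemma sq_summable_diff_quot_adj (a : disk) (g : H2) :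
  sq_summable (diff_quot_adj_seq a (coef g)).
Proof.
apply (sq_summable_bounded _ _ (diff_quot_adj_seq_bound a g)).
Qed.

(** The adjoint of the difference quotient [f |-> (f - f a) / (z - a)].  Working
    with the adjoint keeps the recursion on coefficients finite, and its iterates on
    [kernel a] represent the Taylor coefficients at [a]. *)
Definition diff_quot_adj (a : disk) (g : H2) : H2 :=
  of_seq _ (sq_summable_diff_quot_adj a g).

Lemma coef_diff_quot_adj (a : disk) (g : H2) (n : nat) :
  coef (diff_quot_adj a g) n = diff_quot_adj_seq a (coef g) n.
Proof. apply (coef_of_seq _ (sq_summable_diff_quot_adj a g)). Qed.

Lemma norm_diff_quot_adj (a : disk) (g : H2) :
  H2_norm (diff_quot_adj a g) <= H2_norm g / (1 - Cmod a).
Proof.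
pose proof (disk_lt a); pose proof (H2_norm_ge0 g).
assert (0 <= H2_norm g / (1 - Cmod a)) by (apply Rdiv_le_0_compat; lra).
apply Rsqr_incr_0_var; [|assumption].
rewrite !Rsqr_pow2, H2_norm_sq, (sq_sum_ext _ _ (coef_diff_quot_adj a g)).
apply sq_sum_le; [apply sq_summable_diff_quot_adj|apply diff_quot_adj_seq_bound].
Qed.

Lemma diff_quot_adj_plus (a : disk) (f g : H2) :
  diff_quot_adj a (H2_plus f g) = H2_plus (diff_quot_adj a f) (diff_quot_adj a g).
Proof.
apply H2_coef_ext; intros n; rewrite coef_plus, !coef_diff_quot_adj.
induction n as [|n IH]; simpl; [ring|rewrite IH, coef_plus; ring].
Qed.

Lemma diff_quot_adj_scal (a : disk) (k : C) (f : H2) :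
  diff_quot_adj a (H2_scal k f) = H2_scal k (diff_quot_adj a f).
Proof.
apply H2_coef_ext; intros n; rewrite coef_scal, !coef_diff_quot_adj.
induction n as [|n IH]; simpl; [ring|rewrite IH, coef_scal; ring].
Qed.

(** Adjoint form of [f z = f a + (z - a) * (f z - f a) / (z - a)]. *)
Lemma kernel_split (a z : disk) :
  kernel z = H2_plus (kernel a)
               (H2_scal (Cconj (z - a)%C) (diff_quot_adj a (kernel z))).
Proof.
apply H2_coef_ext; intros n; rewrite coef_plus, coef_scal, coef_diff_quot_adj, !coef_kernel.
rewrite !Cpow_conj, Cminus_conj.
induction n as [|n IH]; simpl; [ring|].
rewrite coef_kernel, Cpow_conj, IH; ring.
Qed.

Lemma iter_kernel_split (a z : disk) (n : nat) :
  Nat.iter n (diff_quot_adj a) (kernel z)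
  = H2_plus (Nat.iter n (diff_quot_adj a) (kernel a))
      (H2_scal (Cconj (z - a)%C) (Nat.iter (S n) (diff_quot_adj a) (kernel z))).
Proof.
induction n as [|n IH]; [apply kernel_split|].
simpl in *; rewrite IH at 1; rewrite diff_quot_adj_plus, diff_quot_adj_scal; reflexivity.
Qed.

(** The remainder of order [n] of [f] at [a], divided by [(z - a) ^ n]. *)
Definition taylor_quot (a : disk) (n : nat) (f : H2) (z : disk) : C :=
  inner f (Nat.iter n (diff_quot_adj a) (kernel z)).

Definition taylor_functional (a : disk) (n : nat) : H2 :=
  Nat.iter n (diff_quot_adj a) (kernel a).

Definition taylor_coef (a : disk) (n : nat) (f : H2) : C :=
  inner f (taylor_functional a n).

Lemma taylor_quot_0 (a : disk) (f : H2) (z : disk) : taylor_quot a 0 f z = f z.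
Proof. apply inner_kernel. Qed.

Lemma taylor_quot_S (a : disk) (n : nat) (f : H2) (z : disk) :
  taylor_quot a n f z = (taylor_coef a n f + (z - a) * taylor_quot a (S n) f z)%C.
Proof.
unfold taylor_quot; rewrite iter_kernel_split, inner_plus_r, inner_scal_r, Cconj_conj.
reflexivity.
Qed.

Lemma taylor_vanish (a : disk) (n : nat) (f : H2) (z : disk) :
  (forall k, (k < n)%nat -> taylor_coef a k f = RtoC 0) ->
  f z = ((z - a) ^ n * taylor_quot a n f z)%C.
Proof.
induction n as [|n IH]; intros H.
- rewrite taylor_quot_0; simpl; ring.
- rewrite IH, taylor_quot_S, H by auto; simpl; ring.
Qed.

Lemma norm_kernel (z : disk) : H2_norm (kernel z) <= / (1 - Cmod z).
Proof.
pose proof (disk_lt z) as Hz; pose proof (Cmod_ge_0 z) as Hz0.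
assert (P : 0 < / (1 - Cmod z)) by (apply Rinv_0_lt_compat; lra).
apply Rsqr_incr_0_var; [|lra].
rewrite !Rsqr_pow2, H2_norm_sq, (sq_sum_ext _ _ (coef_kernel z)).
assert (E : sq_sum (fun n => Cconj (z ^ n)%C) = / (1 - Cmod z ^ 2)).
{ apply is_series_unique.
  apply (is_series_ext (fun n => (Cmod z ^ 2) ^ n)).
  - intros n; rewrite Cmod_conj, Cmod_pow, <- !pow_mult, Nat.mul_comm; reflexivity.
  - apply is_series_geom; rewrite Rabs_pos_eq by apply pow2_ge_0; nra. }
rewrite E, pow_inv; apply Rinv_le_contravar; nra.
Qed.

(** The geometric growth in [n] shows that the Taylor series at [a] converges in
    the largest disk around [a] inside the unit disk. *)
Lemma taylor_quot_bound (a : disk) (n : nat) (f : H2) (z : disk) :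
  Cmod (taylor_quot a n f z)
  <= (/ (1 - Cmod a)) ^ n * (H2_norm f * / (1 - Cmod z)).
Proof.
pose proof (disk_lt a) as Ha; pose proof (H2_norm_ge0 f).
assert (0 < / (1 - Cmod a)) by (apply Rinv_0_lt_compat; lra).
assert (K : H2_norm (Nat.iter n (diff_quot_adj a) (kernel z))
            <= (/ (1 - Cmod a)) ^ n * / (1 - Cmod z)).
{ induction n as [|n IH]; simpl.
  - rewrite Rmult_1_l; apply norm_kernel.
  - apply Rle_trans with (1 := norm_diff_quot_adj a _).
    unfold Rdiv; rewrite Rmult_comm, Rmult_assoc; apply Rmult_le_compat_l; lra. }
apply Rle_trans with (1 := cauchy_schwarz _ _).
replace ((/ (1 - Cmod a)) ^ n * (H2_norm f * / (1 - Cmod z)))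
  with (H2_norm f * ((/ (1 - Cmod a)) ^ n * / (1 - Cmod z))) by ring.
apply Rmult_le_compat_l; assumption.
Qed.

Lemma taylor_quot_locally_bounded (a : disk) (n : nat) (f : H2) :
  exists M, 0 <= M /\ forall z : disk, Cmod (z - a)%C < (1 - Cmod a) / 2 ->
    Cmod (taylor_quot a n f z) <= M.
Proof.
pose proof (disk_lt a) as Ha; pose proof (H2_norm_ge0 f).
exists ((/ (1 - Cmod a)) ^ n * (H2_norm f * / ((1 - Cmod a) / 2))).
assert (0 < / (1 - Cmod a)) by (apply Rinv_0_lt_compat; lra).
assert (0 < / ((1 - Cmod a) / 2)) by (apply Rinv_0_lt_compat; lra).
pose proof (pow_le _ n (Rlt_le _ _ H0)).
split.
- apply Rmult_le_pos; [|apply Rmult_le_pos]; lra.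
- intros z Hz; apply Rle_trans with (1 := taylor_quot_bound a n f z).
  apply Rmult_le_compat_l; [lra|]; apply Rmult_le_compat_l; [lra|].
  apply Rinv_le_contravar; [lra|].
  replace (disk_val z) with ((z - a) + a)%C by ring.
  pose proof (Cmod_triangle (z - a)%C a); lra.
Qed.

(** The expansion [f = c (z - a) ^ n + O((z - a) ^ (n + 1))].  It refers to values
    only, hence is easy to compose, while by [jet_taylor_coef] and [taylor_coef_jet]
    it determines the Taylor coefficients up to order [n]. *)
Definition jet (a : disk) (f : disk -> C) (n : nat) (c : C) : Prop :=
  exists d M, 0 < d /\ 0 <= M /\ forall z : disk, Cmod (z - a)%C < d ->
    Cmod (f z - c * (z - a) ^ n)%C <= M * Cmod (z - a)%C ^ S n.

Lemma jet_taylor_coef (a : disk) (n : nat) (f : H2) :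
  (forall k, (k < n)%nat -> taylor_coef a k f = RtoC 0) ->
  jet a f n (taylor_coef a n f).
Proof.
intros H; destruct (taylor_quot_locally_bounded a (S n) f) as [M [M0 HM]].
pose proof (disk_lt a).
exists ((1 - Cmod a) / 2), M; split; [lra|split; [exact M0|]].
intros z Hz; rewrite (taylor_vanish a n f z H), taylor_quot_S.
replace (_ - _)%C with ((z - a) ^ S n * taylor_quot a (S n) f z)%C by (simpl; ring).
rewrite Cmod_mult, Cmod_pow, Rmult_comm.
apply Rmult_le_compat_r; [apply pow_le, Cmod_ge_0|apply HM, Hz].
Qed.

Lemma disk_translate (a : disk) (t : R) :
  0 < t < 1 - Cmod a -> exists z : disk, (z - a)%C = RtoC t.
Proof.
intros Ht.
assert (h : Cmod (a + RtoC t)%C < 1).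
{ pose proof (Cmod_triangle a (RtoC t)) as T.
  rewrite Cmod_R, Rabs_pos_eq in T; lra. }
exists (mkDisk _ h); simpl; ring.
Qed.

Lemma jet_unique (a : disk) (f : disk -> C) (n : nat) (c c' : C) :
  jet a f n c -> jet a f n c' -> c = c'.
Proof.
intros (d & M & d0 & M0 & H) (d' & M' & d0' & M0' & H').
pose proof (disk_lt a) as Ha.
apply C_eq_of_close; intros e He.
set (t := Rmin (Rmin d d') (Rmin (1 - Cmod a) (e / (M + M' + 1))) / 2).
assert (Q : 0 < e / (M + M' + 1)) by (apply Rdiv_lt_0_compat; lra).
assert (T : 0 < t /\ t < d /\ t < d' /\ t < 1 - Cmod a /\ t < e / (M + M' + 1)).
{ unfold t; unfold Rmin; repeat destruct Rle_dec; lra. }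
clearbody t; destruct T as (t0 & t1 & t2 & t3 & t4).
destruct (disk_translate a t) as [z Hz]; [lra|].
specialize (H z); specialize (H' z); rewrite Hz, Cmod_R, Rabs_pos_eq in H, H' by lra.
specialize (H t1); specialize (H' t2).
assert (E : Cmod (c - c')%C * t ^ n <= (M + M') * t * t ^ n).
{ replace (t ^ n) with (Cmod (RtoC t ^ n)%C) at 1
    by (rewrite Cmod_pow, Cmod_R, Rabs_pos_eq; lra).
  rewrite <- Cmod_mult.
  replace ((c - c') * RtoC t ^ n)%C
    with ((f z - c' * RtoC t ^ n) + - (f z - c * RtoC t ^ n))%C by ring.
  apply Rle_trans with (1 := Cmod_triangle _ _); rewrite Cmod_opp.
  simpl in H, H'; lra. }
apply Rmult_le_reg_r in E; [|apply pow_lt; lra].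
apply Rle_trans with (1 := E).
apply Rmult_lt_compat_r with (r := M + M' + 1) in t4; [|lra].
replace (e / (M + M' + 1) * (M + M' + 1)) with e in t4 by (field; lra); nra.
Qed.

Lemma jet_lower (a : disk) (f : disk -> C) (n : nat) (c : C) :
  jet a f (S n) c -> jet a f n (RtoC 0).
Proof.
intros (d & M & d0 & M0 & H); pose proof (Cmod_ge_0 c) as Hc.
exists (Rmin d 1), (M + Cmod c); split; [apply Rmin_pos; lra|split; [lra|]].
intros z Hz.
assert (Hd : Cmod (z - a)%C < d) by (pose proof (Rmin_l d 1); lra).
assert (H1 : Cmod (z - a)%C < 1) by (pose proof (Rmin_r d 1); lra).
specialize (H z Hd).
replace (f z - RtoC 0 * (z - a) ^ n)%C
  with ((f z - c * (z - a) ^ S n) + c * (z - a) ^ S n)%C by ring.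
apply Rle_trans with (1 := Cmod_triangle _ _); rewrite Cmod_mult, Cmod_pow.
pose proof (Cmod_ge_0 (z - a)%C) as P; pose proof (pow_le _ (S n) P) as Pn.
replace (Cmod (z - a)%C ^ S (S n)) with (Cmod (z - a)%C * Cmod (z - a)%C ^ S n) in H
  by reflexivity.
assert (M * (Cmod (z - a)%C * Cmod (z - a)%C ^ S n) <= M * Cmod (z - a)%C ^ S n).
{ apply Rmult_le_compat_l; [exact M0|].
  rewrite <- (Rmult_1_l (Cmod (z - a)%C ^ S n)) at 2.
  apply Rmult_le_compat_r; lra. }
lra.
Qed.

(** Lowering the order gives coefficients [0] below [n] by induction; then the two
    expansions of order [n] have the same leading coefficient. *)
Lemma taylor_coef_jet (a : disk) (n : nat) (f : H2) (c : C) :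
  jet a f n c ->
  (forall k, (k < n)%nat -> taylor_coef a k f = RtoC 0) /\ taylor_coef a n f = c.
Proof.
revert c; induction n as [|n IH]; intros c H.
- split; [intros k Hk; lia|].
  apply (jet_unique a f 0); [apply jet_taylor_coef; intros k Hk; lia|exact H].
- destruct (IH _ (jet_lower _ _ _ _ H)) as [H0 H1].
  assert (V : forall k, (k < S n)%nat -> taylor_coef a k f = RtoC 0).
  { intros k Hk; destruct (Nat.eq_dec k n) as [->|]; [exact H1|apply H0; lia]. }
  split; [exact V|].
  apply (jet_unique a f (S n)); [apply jet_taylor_coef, V|exact H].
Qed.

(** * Identity theorem *)

Lemma taylor_vanish_ball (a : disk) (f : H2) (z : disk) :
  (forall k, taylor_coef a k f = RtoC 0) -> Cmod (z - a)%C < 1 - Cmod a -> f z = RtoC 0.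
Proof.
intros H Hz; pose proof (disk_lt a) as Ha; pose proof (disk_lt z) as Hz1.
set (q := Cmod (z - a)%C * / (1 - Cmod a)).
set (K := H2_norm f * / (1 - Cmod z)).
assert (I : 0 < / (1 - Cmod a)) by (apply Rinv_0_lt_compat; lra).
assert (K0 : 0 <= K).
{ apply Rmult_le_pos; [apply H2_norm_ge0|apply Rlt_le, Rinv_0_lt_compat; lra]. }
assert (Q : 0 <= q < 1).
{ split; [apply Rmult_le_pos; [apply Cmod_ge_0|lra]|].
  unfold q; apply (Rmult_lt_reg_r (1 - Cmod a)); [lra|].
  rewrite Rmult_assoc, Rinv_l by lra; lra. }
assert (B : forall n, Cmod (f z) <= q ^ n * K).
{ intros n; rewrite (taylor_vanish a n f z) by auto.
  rewrite Cmod_mult, Cmod_pow; unfold q; rewrite Rpow_mult_distr, Rmult_assoc.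
  apply Rmult_le_compat_l; [apply pow_le, Cmod_ge_0|apply taylor_quot_bound]. }
apply Cmod_eq_0, Rle_antisym; [|apply Cmod_ge_0].
apply le_epsilon; intros e He; rewrite Rplus_0_l.
destruct (pow_lt_1_zero q) with (y := e / (K + 1)) as [N HN].
- rewrite Rabs_pos_eq; lra.
- apply Rdiv_lt_0_compat; lra.
- specialize (HN N (le_n N)); specialize (B N).
  rewrite Rabs_pos_eq in HN by (apply pow_le; lra).
  pose proof (pow_le q N (proj1 Q)).
  apply Rmult_lt_compat_r with (r := K + 1) in HN; [|lra].
  replace (e / (K + 1) * (K + 1)) with e in HN by (field; lra); nra.
Qed.

Lemma taylor_recenter (a b : disk) (f : H2) :
  (forall k, taylor_coef a k f = RtoC 0) -> Cmod (b - a)%C < 1 - Cmod a ->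
  forall k, taylor_coef b k f = RtoC 0.
Proof.
intros H Hb k; apply (taylor_coef_jet b k f).
exists (1 - Cmod a - Cmod (b - a)%C), 0; split; [lra|split; [lra|]].
intros z Hz; rewrite (taylor_vanish_ball a f z H).
- replace (RtoC 0 - RtoC 0 * (z - b) ^ k)%C with (RtoC 0) by ring; rewrite Cmod_0; lra.
- replace (z - a)%C with ((z - b) + (b - a))%C by ring.
  pose proof (Cmod_triangle (z - b)%C (b - a)%C); lra.
Qed.

(** Vanishing spreads from the centre [a] to the disk of radius [1 - |a|], whose
    points may serve as new centres; finitely many steps along the segment from [a]
    to the origin reach a disk that contains [0]. *)
Lemma identity_theorem (a : disk) (f : H2) :
  (forall k, taylor_coef a k f = RtoC 0) -> f = H2_zero.
Proof.
pose proof (disk_lt a) as Ha.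
assert (h0 : Cmod (RtoC 0) < 1) by (rewrite Cmod_0; lra).
assert (base : forall b : disk, Cmod b < 1 / 2 ->
  (forall k, taylor_coef b k f = RtoC 0) -> f = H2_zero).
{ intros b Hb H; apply H2_ext; intros z.
  apply (taylor_vanish_ball (mkDisk _ h0)).
  - apply (taylor_recenter b); [exact H|simpl].
    replace (RtoC 0 - b)%C with (- b)%C by ring; rewrite Cmod_opp; lra.
  - simpl; rewrite Cmod_0; replace (z - RtoC 0)%C with (disk_val z) by ring.
    pose proof (disk_lt z); lra. }
destruct (Pow_x_infinity (3 / 2)) with (b := / (1 - Cmod a)) as [m Hm].
{ rewrite Rabs_pos_eq; lra. }
specialize (Hm m (le_n m)).
rewrite Rabs_pos_eq in Hm by (apply pow_le; lra).
assert (Hm' : 1 <= (1 - Cmod a) * (3 / 2) ^ m).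
{ apply Rge_le, (Rmult_le_compat_l (1 - Cmod a)) in Hm; [|lra].
  rewrite Rinv_r in Hm by lra; lra. }
clear Hm; revert a Ha Hm'; induction m as [|m IH]; intros a Ha Hm H.
- apply (base a); [simpl in Hm; lra|exact H].
- destruct (Rlt_le_dec (Cmod a) (1 / 2)) as [L|L]; [apply (base a L H)|].
  (* moving the centre towards [0] by half the radius of the disk of vanishing
     multiplies the distance to the circle by [3/2] *)
  set (s := (3 * Cmod a - 1) / (2 * Cmod a)).
  assert (E : s * Cmod a = Cmod a - (1 - Cmod a) / 2) by (unfold s; field; lra).
  assert (s0 : 0 < s) by (unfold s; apply Rdiv_lt_0_compat; lra).
  assert (Es : Cmod (RtoC s * a)%C = Cmod a - (1 - Cmod a) / 2).
  { rewrite Cmod_mult, Cmod_R, Rabs_pos_eq by lra; exact E. }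
  assert (h : Cmod (RtoC s * a)%C < 1) by lra.
  apply (IH (mkDisk _ h)); simpl.
  + exact h.
  + rewrite Es; simpl in Hm; lra.
  + apply (taylor_recenter a); [exact H|simpl].
    replace (RtoC s * a - a)%C with (RtoC (s - 1) * a)%C by (rewrite RtoC_minus; ring).
    rewrite Cmod_mult, Cmod_R, Rabs_left1 by nra; lra.
Qed.

(** * Composition operators on Taylor expansions *)

(** A function of [H2] has a quadratic remainder at [a], so the complex derivative,
    which only controls a remainder [o(z - a)], is its first Taylor coefficient. *)
Lemma jet_derivative (a : disk) (h : H2) (l : C) :
  has_derivative h a l -> jet a (fun z => h z - h a)%C 1 l.
Proof.
intros Hd.
destruct (taylor_quot_locally_bounded a 2 h) as [M [M0 HM]].
pose proof (disk_lt a) as Ha.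
set (c := taylor_coef a 1 h).
assert (E : forall z, (h z - h a - c * (z - a) ^ 1 = (z - a) ^ 2 * taylor_quot a 2 h z)%C).
{ intros z; rewrite <- (taylor_quot_0 a h z), <- (taylor_quot_0 a h a).
  rewrite (taylor_quot_S a 0 h z), (taylor_quot_S a 0 h a), (taylor_quot_S a 1 h z).
  fold c; ring. }
assert (J : jet a (fun z => h z - h a)%C 1 c).
{ exists ((1 - Cmod a) / 2), M; split; [lra|split; [exact M0|]].
  intros z Hz; rewrite E, Cmod_mult, Cmod_pow, Rmult_comm.
  apply Rmult_le_compat_r; [apply pow_le, Cmod_ge_0|apply HM, Hz]. }
replace l with c; [exact J|].
apply C_eq_of_close; intros e He.
destruct J as (d & M' & d0 & M0' & J).
assert (He2 : 0 < e / 2) by lra.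
(* testing both expansions at the points [a + t] for small real [t] *)
destruct Hd as [_ Hd].
specialize (Hd (disk_val a) (fun P HP => HP) (mkposreal _ He2)).
destruct Hd as [d' Hd]; pose proof (cond_pos d') as d0'.
set (t := Rmin (Rmin d d') (Rmin (1 - Cmod a) (e / 2 / (M' + 1))) / 2).
assert (Q : 0 < e / 2 / (M' + 1)) by (apply Rdiv_lt_0_compat; lra).
assert (T : 0 < t /\ t < d /\ t < d' /\ t < 1 - Cmod a /\ t < e / 2 / (M' + 1)).
{ unfold t; unfold Rmin; repeat destruct Rle_dec; lra. }
clearbody t; destruct T as (t0 & t1 & t2 & t3 & t4).
destruct (disk_translate a t) as [z Hz]; [lra|].
specialize (J z); rewrite Hz, Cmod_R, Rabs_pos_eq in J by lra; specialize (J t1).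
assert (X : forall y : disk, extend h y = h y).
{ intros y; unfold extend; destruct (Rlt_dec (Cmod y) 1) as [p|p].
  - destruct y as [y p']; simpl in *; rewrite (proof_irrelevance _ p p'); reflexivity.
  - destruct p; apply disk_lt. }
specialize (Hd (disk_val z)).
assert (B : Cmod (z - a)%C < d') by (rewrite Hz, Cmod_R, Rabs_pos_eq; lra).
specialize (Hd B); rewrite !X in Hd.
change (Cmod (h z - h a - (z - a) * l)%C <= e / 2 * Cmod (z - a)%C) in Hd.
rewrite Hz, Cmod_R, Rabs_pos_eq in Hd by lra.
assert (F : Cmod (c - l)%C * t <= (M' * t + e / 2) * t).
{ replace t with (Cmod (RtoC t)) at 1 by (rewrite Cmod_R, Rabs_pos_eq; lra).
  rewrite <- Cmod_mult.
  replace ((c - l) * RtoC t)%C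
    with ((h z - h a - RtoC t * l) + - (h z - h a - c * RtoC t))%C by ring.
  apply Rle_trans with (1 := Cmod_triangle _ _); rewrite Cmod_opp.
  rewrite Cpow_1_r in J; simpl in J; lra. }
apply Rmult_le_reg_r in F; [|lra].
apply Rmult_lt_compat_r with (r := M' + 1) in t4; [|lra].
replace (e / 2 / (M' + 1) * (M' + 1)) with (e / 2) in t4 by (field; lra); nra.
Qed.

Lemma pow_approx (l : C) (B M : R) (n : nat) :
  0 <= B -> 0 <= M ->
  exists P, 0 <= P /\ forall w h : C,
    Cmod h <= B * Cmod w -> Cmod (h - l * w)%C <= M * Cmod w ^ 2 ->
    Cmod (h ^ n - (l * w) ^ n)%C <= P * Cmod w ^ S n.
Proof.
intros B0 M0; induction n as [|n [P [P0 IH]]].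
- exists 0; split; [lra|]; intros w h _ _; simpl.
  replace (1 - 1)%C with (RtoC 0) by ring; rewrite Cmod_0; lra.
- exists (B * P + M * Cmod l ^ n); split.
  + pose proof (pow_le _ n (Cmod_ge_0 l)); nra.
  + intros w h H1 H2; specialize (IH w h H1 H2).
    replace (h ^ S n - (l * w) ^ S n)%C
      with (h * (h ^ n - (l * w) ^ n) + (h - l * w) * (l * w) ^ n)%C by (simpl; ring).
    apply Rle_trans with (1 := Cmod_triangle _ _).
    rewrite !Cmod_mult, (Cmod_pow (l * w)%C), Cmod_mult, Rpow_mult_distr.
    pose proof (Cmod_ge_0 w) as w0; pose proof (pow_le _ n w0) as wn.
    pose proof (pow_le _ n (Cmod_ge_0 l)) as ln.
    pose proof (Rmult_le_compat _ _ _ _ (Cmod_ge_0 _) (Cmod_ge_0 _) H1 IH) as K1.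
    pose proof (Rmult_le_compat_r _ _ _ (Rmult_le_pos _ _ ln wn) H2) as K2.
    simpl in *; lra.
Qed.

Lemma jet_comp (phi : disk -> disk) (a : disk) (l : C) (f : disk -> C) (n : nat) (c : C) :
  jet a (fun z => phi z - a)%C 1 l -> jet a f n c ->
  jet a (fun z => f (phi z)) n (l ^ n * c)%C.
Proof.
intros (d1 & M1 & d1p & M1p & H1) (d & M & dp & Mp & H).
set (B := Cmod l + M1).
assert (B0 : 0 <= B) by (pose proof (Cmod_ge_0 l); unfold B; lra).
destruct (pow_approx l B M1 n B0 M1p) as (P & P0 & HP).
exists (Rmin (Rmin d1 1) (d / (B + 1))), (M * B ^ S n + Cmod c * P).
assert (Q : 0 < d / (B + 1)) by (apply Rdiv_lt_0_compat; lra).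
split; [repeat apply Rmin_pos; lra|split].
{ pose proof (pow_le _ (S n) B0); pose proof (Cmod_ge_0 c); nra. }
intros z Hz.
set (w := (z - a)%C) in *; set (h := (phi z - a)%C).
assert (z1 : Cmod w < d1 /\ Cmod w < 1 /\ Cmod w < d / (B + 1)).
{ pose proof (Rmin_l (Rmin d1 1) (d / (B + 1))); pose proof (Rmin_r (Rmin d1 1) (d / (B + 1))).
  pose proof (Rmin_l d1 1); pose proof (Rmin_r d1 1); lra. }
destruct z1 as (z1 & z2 & z3).
pose proof (Cmod_ge_0 w) as w0.
specialize (H1 z z1); fold w h in H1.
assert (Hw : Cmod (h - l * w)%C <= M1 * Cmod w ^ 2).
{ rewrite Cpow_1_r in H1; exact H1. }
assert (Hh : Cmod h <= B * Cmod w).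
{ replace h with ((h - l * w) + l * w)%C by ring.
  apply Rle_trans with (1 := Cmod_triangle _ _); rewrite Cmod_mult; unfold B.
  simpl in Hw; assert (Cmod w * Cmod w <= Cmod w) by nra; nra. }
assert (Hhd : Cmod h < d).
{ apply Rmult_lt_compat_r with (r := B + 1) in z3; [|lra].
  replace (d / (B + 1) * (B + 1)) with d in z3 by (field; lra); nra. }
specialize (H (phi z) Hhd); fold h in H.
specialize (HP w h Hh Hw).
replace (f (phi z) - l ^ n * c * w ^ n)%C
  with ((f (phi z) - c * h ^ n) + c * (h ^ n - (l * w) ^ n))%C
  by (rewrite Cpow_mult_l; ring).
apply Rle_trans with (1 := Cmod_triangle _ _); rewrite Cmod_mult.
pose proof (pow_incr _ _ (S n) (conj (Cmod_ge_0 h) Hh)) as K.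
rewrite Rpow_mult_distr in K.
apply (Rmult_le_compat_l M) in K; [|exact Mp].
apply (Rmult_le_compat_l (Cmod c)) in HP; [|apply Cmod_ge_0].
lra.
Qed.

Definition vanishes (a : disk) (n : nat) (f : H2) : Prop :=
  forall k, (k < n)%nat -> taylor_coef a k f = RtoC 0.

Lemma vanishes_S (a : disk) (n : nat) (f : H2) :
  vanishes a n f -> taylor_coef a n f = RtoC 0 -> vanishes a (S n) f.
Proof.
intros H H0 k Hk; destruct (Nat.eq_dec k n) as [->|]; [exact H0|apply H; lia].
Qed.

(** Triangularity of [T], with diagonal [1, l, l ^ 2, ...], with respect to the
    Taylor coefficients at [a]. *)
Definition triangular (a : disk) (l : C) (T : H2 -> H2) : Prop :=
  forall (n : nat) (f : H2), vanishes a n f ->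
    vanishes a n (T f) /\ taylor_coef a n (T f) = (l ^ n * taylor_coef a n f)%C.

(** [phi] is the image of the coordinate function under [T], so it lies in [H2] and
    has a second-order expansion at [a], which is substituted in that of [f]. *)
Lemma composition_triangular (phi : disk -> disk) (T : H2 -> H2) (a : disk) (l : C) :
  is_composition_operator phi T -> phi a = a -> has_derivative (fun z => phi z) a l ->
  triangular a l T.
Proof.
intros HT Ha Hd n f Hf.
assert (Hphi : forall z, T (monomial 1) z = disk_val (phi z)).
{ intros z; rewrite HT; apply monomial_1. }
assert (J : jet a (fun z => phi z - a)%C 1 l).
{ assert (D : has_derivative (T (monomial 1)) a l).
  { replace (H2_fun (T (monomial 1))) with (fun z => disk_val (phi z)); [exact Hd|].
    apply functional_extensionality; intros z.
    symmetry; apply Hphi. }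
  destruct (jet_derivative a _ l D) as (d & M & H).
  exists d, M; rewrite Hphi, Ha in H.
  destruct H as (d0 & M0 & H); split; [exact d0|split; [exact M0|]].
  intros z Hz; specialize (H z Hz); rewrite Hphi in H; exact H. }
apply (taylor_coef_jet a n (T f)).
destruct (jet_comp phi a l f n _ J (jet_taylor_coef a n f Hf)) as (d & M & d0 & M0 & H).
exists d, M; split; [exact d0|split; [exact M0|]].
intros z Hz; rewrite HT; exact (H z Hz).
Qed.

(** * Eigenvectors *)

Lemma op_plus (T : H2 -> H2) (f g : H2) :
  bounded_operator T -> T (H2_plus f g) = H2_plus (T f) (T g).
Proof. intros H; exact (linear_plus _ H f g). Qed.

Lemma op_scal (T : H2 -> H2) (k : C) (f : H2) :
  bounded_operator T -> T (H2_scal k f) = H2_scal k (T f).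
Proof. intros H; exact (linear_scal _ H k f). Qed.

Lemma scal_0 (f : H2) : H2_scal (RtoC 0) f = H2_zero.
Proof. apply H2_ext; intros z; simpl; ring. Qed.

Lemma op_zero (T : H2 -> H2) : bounded_operator T -> T H2_zero = H2_zero.
Proof. intros H; rewrite <- (scal_0 H2_zero), op_scal, !scal_0 by exact H; reflexivity. Qed.

Lemma op_minus (T : H2 -> H2) (f g : H2) :
  bounded_operator T -> T (H2_minus f g) = H2_minus (T f) (T g).
Proof. intros H; unfold H2_minus, H2_opp; rewrite op_plus, op_scal by exact H; reflexivity. Qed.

Lemma Cpow_inj (l : C) (m n : nat) : 0 < Cmod l < 1 -> (l ^ m)%C = (l ^ n)%C -> m = n.
Proof.
intros Hl H.
assert (E : Cmod l ^ m = Cmod l ^ n) by (rewrite <- !Cmod_pow, H; reflexivity).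
assert (K : forall i k, Cmod l ^ (i + S k) < Cmod l ^ i).
{ intros i k; rewrite pow_add.
  assert (P : 0 < Cmod l ^ i) by (apply pow_lt; lra).
  assert (Q : 0 <= Cmod l ^ S k < 1) by (apply pow_lt_1_compat; [lra|lia]).
  nra. }
destruct (Nat.lt_trichotomy m n) as [h|[h|h]]; [|exact h|].
- specialize (K m (n - m - 1)%nat); replace (m + S (n - m - 1))%nat with n in K by lia; lra.
- specialize (K n (m - n - 1)%nat); replace (n + S (m - n - 1))%nat with m in K by lia; lra.
Qed.

Lemma Cmult_cancel (x y k : C) : x <> y -> (x * k = y * k)%C -> k = RtoC 0.
Proof.
intros Hxy H.
assert (D : (x - y)%C <> RtoC 0).
{ intros D; apply Hxy; replace x with ((x - y) + y)%C by ring; rewrite D; ring. }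
replace k with ((x * k - y * k) / (x - y))%C by (field; exact D).
rewrite H; field; exact D.
Qed.

(** For [k <> n], triangularity gives [l ^ k * c = l ^ n * c] for the first
    coefficient [c] that may be nonzero. *)
Lemma eigenfunction_eq0 (a : disk) (l : C) (T : H2 -> H2) (n : nat) (f : H2) :
  triangular a l T -> 0 < Cmod l < 1 ->
  T f = H2_scal (l ^ n)%C f -> taylor_coef a n f = RtoC 0 -> f = H2_zero.
Proof.
intros HT Hl Hf H0.
assert (V : forall k, vanishes a k f).
{ induction k as [|k IH]; [intros k Hk; lia|].
  apply vanishes_S; [exact IH|].
  destruct (Nat.eq_dec k n) as [->|Hk]; [exact H0|].
  destruct (HT k f IH) as [_ H]; rewrite Hf in H.
  unfold taylor_coef in H; rewrite inner_scal_l in H.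
  apply Cmult_cancel with (2 := H); intros E; apply Hk; symmetry.
  exact (Cpow_inj l n k Hl E). }
apply (identity_theorem a); intros k; apply (V (S k)); lia.
Qed.

(** The combination of two eigenfunctions that cancels the [n]-th coefficient is
    [0]. *)
Lemma eigenspace_dim1 (a : disk) (l : C) (T : H2 -> H2) (n : nat) (f g : H2) :
  bounded_operator T -> triangular a l T -> 0 < Cmod l < 1 ->
  T f = H2_scal (l ^ n)%C f -> T g = H2_scal (l ^ n)%C g -> f <> H2_zero ->
  exists k, g = H2_scal k f.
Proof.
intros BT HT Hl Hf Hg f0.
set (x := taylor_coef a n f); set (y := taylor_coef a n g).
assert (x0 : x <> RtoC 0).
{ intros E; exact (f0 (eigenfunction_eq0 a l T n f HT Hl Hf E)). }
exists (y / x)%C; apply H2_minus_eq0, (eigenfunction_eq0 a l T n); auto.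
- rewrite (op_minus T), (op_scal T), Hf, Hg by exact BT.
  apply H2_ext; intros z; simpl; ring.
- unfold taylor_coef; rewrite inner_minus_l, inner_scal_l.
  fold (taylor_coef a n f) (taylor_coef a n g); fold x y; field; exact x0.
Qed.

Inductive eigen_span (S : H2 -> H2) (m : C) (n : nat) : H2 -> Prop :=
| eigen_span_zero : eigen_span S m n H2_zero
| eigen_span_add w v j :
    eigen_span S m n w -> (j < n)%nat -> S v = H2_scal (m ^ j)%C v ->
    eigen_span S m n (H2_plus w v).

Lemma eigen_span_plus (S : H2 -> H2) (m : C) (n : nat) (f g : H2) :
  eigen_span S m n f -> eigen_span S m n g -> eigen_span S m n (H2_plus f g).
Proof.
intros Hf Hg; induction Hg as [|w v j Hw IH Hj Hv].
- rewrite H2_plus_zero_r; exact Hf.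
- rewrite H2_plus_assoc; exact (eigen_span_add S m n _ v j IH Hj Hv).
Qed.

Lemma eigen_span_scal (S : H2 -> H2) (m k : C) (n : nat) (f : H2) :
  bounded_operator S -> eigen_span S m n f -> eigen_span S m n (H2_scal k f).
Proof.
intros BS Hf; induction Hf as [|w v j Hw IH Hj Hv].
- replace (H2_scal k H2_zero) with H2_zero by (apply H2_ext; intros z; simpl; ring).
  constructor.
- rewrite H2_scal_distr_l; apply (eigen_span_add S m n _ _ j IH Hj).
  rewrite (op_scal S), Hv by exact BS; apply H2_ext; intros z; simpl; ring.
Qed.

Lemma eigen_span_incl (S : H2 -> H2) (m : C) (n n' : nat) (f : H2) :
  (n <= n')%nat -> eigen_span S m n f -> eigen_span S m n' f.
Proof.
intros Hn Hf; induction Hf as [|w v j Hw IH Hj Hv]; [constructor|].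
apply (eigen_span_add S m n' w v j IH); [lia|exact Hv].
Qed.

(** [S - m ^ n] is invertible on this span, because [m ^ n] differs from the
    eigenvalues [m ^ j] with [j < n]. *)
Lemma eigen_span_solve (S : H2 -> H2) (m : C) (n : nat) (w : H2) :
  bounded_operator S -> 0 < Cmod m < 1 -> eigen_span S m n w ->
  exists y, eigen_span S m n y /\ w = H2_minus (S y) (H2_scal (m ^ n)%C y).
Proof.
intros BS Hm Hw; induction Hw as [|w v j Hw [y [Hy E]] Hj Hv].
- exists H2_zero; split; [constructor|].
  rewrite op_zero by exact BS; apply H2_ext; intros z; simpl; ring.
- assert (D : (m ^ j - m ^ n)%C <> RtoC 0).
  { intros D; assert (j = n); [|lia]; apply (Cpow_inj m); [exact Hm|].
    replace (m ^ j)%C with ((m ^ j - m ^ n) + m ^ n)%C by ring; rewrite D; ring. }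
  set (k := (/ (m ^ j - m ^ n))%C).
  exists (H2_plus y (H2_scal k v)); split.
  + apply (eigen_span_add S m n _ _ j Hy Hj).
    rewrite (op_scal S), Hv by exact BS; apply H2_ext; intros z; simpl; ring.
  + rewrite (op_plus S), (op_scal S), Hv by exact BS; rewrite E.
    apply H2_ext; intros z; simpl; unfold k; rewrite !RtoC_m1; field; exact D.
Qed.

(** Let [W n] be the annihilator of the functions that vanish to order [n] at [a].
    If some function vanishes exactly to order [n], then [W (n + 1)] is spanned by
    [W n] and the functional [k] of the [n]-th coefficient; otherwise it equals
    [W n].  Triangularity puts [S k - m ^ n k], where [m = Cconj l], in [W n].  There
    it has the form [S y - m ^ n y], so [k - y] is an eigenvector. *)
Lemma annihilator_eigen_span (a : disk) (l : C) (T S : H2 -> H2) (n : nat) (w : H2) :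
  triangular a l T -> 0 < Cmod l < 1 -> is_adjoint T S ->
  (forall f, vanishes a n f -> inner f w = RtoC 0) ->
  eigen_span S (Cconj l) n w.
Proof.
intros HT Hl [BS HS].
assert (Hm : 0 < Cmod (Cconj l) < 1) by (rewrite Cmod_conj; exact Hl).
revert w; induction n as [|n IH]; intros w Hw.
- replace w with H2_zero; [constructor|symmetry].
  apply inner_self_eq0, Hw; intros k Hk; lia.
- destruct (classic (exists g, vanishes a n g /\ taylor_coef a n g <> RtoC 0))
    as [[g [Vg g0]]|N].
  + set (k := taylor_functional a n).
    assert (Hk : eigen_span S (Cconj l) (Datatypes.S n) k).
    { assert (X : eigen_span S (Cconj l) n
                    (H2_minus (S k) (H2_scal (Cconj l ^ n)%C k))).
      { apply IH; intros f Vf; destruct (HT n f Vf) as [_ E].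
        rewrite inner_minus_r, <- HS, inner_scal_r, Cpow_conj, Cconj_conj.
        change (inner (T f) k) with (taylor_coef a n (T f)).
        change (inner f k) with (taylor_coef a n f); rewrite E; ring. }
      destruct (eigen_span_solve S _ n _ BS Hm X) as [y [Hy Ey]].
      replace k with (H2_plus y (H2_minus k y))
        by (apply H2_ext; intros z; simpl; rewrite RtoC_m1; ring).
      apply (eigen_span_add S _ _ _ _ n); [|lia|].
      - apply (eigen_span_incl S _ n); [lia|exact Hy].
      - rewrite (op_minus S) by exact BS.
        replace (S k) with (H2_plus (H2_minus (S k) (H2_scal (Cconj l ^ n)%C k))
                              (H2_scal (Cconj l ^ n)%C k))
          by (apply H2_ext; intros z; simpl; rewrite !RtoC_m1; ring).
        rewrite Ey; apply H2_ext; intros z; simpl; rewrite !RtoC_m1; ring. }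
    set (c := Cconj (inner g w / taylor_coef a n g)%C).
    replace w with (H2_plus (H2_minus w (H2_scal c k)) (H2_scal c k))
      by (apply H2_ext; intros z; simpl; rewrite RtoC_m1; ring).
    apply eigen_span_plus; [|apply eigen_span_scal; assumption].
    apply (eigen_span_incl S _ n); [lia|]; apply IH; intros f Vf.
    rewrite inner_minus_r, inner_scal_r; unfold c; rewrite Cconj_conj.
    change (inner f k) with (taylor_coef a n f).
    set (q := (taylor_coef a n f / taylor_coef a n g)%C).
    assert (Z : inner (H2_minus f (H2_scal q g)) w = RtoC 0).
    { apply Hw, vanishes_S.
      - intros i Hi; unfold taylor_coef; rewrite inner_minus_l, inner_scal_l.
        pose proof (Vf i Hi) as E1; pose proof (Vg i Hi) as E2.
        unfold taylor_coef in E1, E2; rewrite E1, E2; ring.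
      - unfold taylor_coef; rewrite inner_minus_l, inner_scal_l.
        fold (taylor_coef a n f) (taylor_coef a n g); unfold q; field; exact g0. }
    rewrite inner_minus_l, inner_scal_l in Z.
    transitivity (inner f w - q * inner g w)%C; [unfold q; field; exact g0|exact Z].
  + apply (eigen_span_incl S _ n); [lia|]; apply IH; intros f Vf.
    apply Hw, vanishes_S; [exact Vf|].
    destruct (classic (taylor_coef a n f = RtoC 0)) as [E|E]; [exact E|].
    destruct N; exists f; split; assumption.
Qed.

(** Such an [f] is orthogonal to the functionals of all Taylor coefficients at [a],
    which are combinations of eigenvectors. *)
Lemma adjoint_eigenvectors_total (a : disk) (l : C) (T S : H2 -> H2) (f : H2) :
  triangular a l T -> 0 < Cmod l < 1 -> is_adjoint T S ->
  (forall n v, S v = H2_scal (Cconj l ^ n)%C v -> inner f v = RtoC 0) ->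
  f = H2_zero.
Proof.
intros HT Hl HS H; apply (identity_theorem a); intros n.
assert (K : eigen_span S (Cconj l) (Datatypes.S n) (taylor_functional a n)).
{ apply (annihilator_eigen_span a l T); auto.
  intros g Vg; apply Vg; lia. }
unfold taylor_coef; induction K as [|w v j Hw IH Hj Hv].
- apply inner_zero_r.
- rewrite inner_plus_r, IH, (H j v Hv); ring.
Qed.

(** * The commutant *)

Lemma conjugation_inner_r (J : H2 -> H2) (f g : H2) :
  conjugation J -> inner f (J g) = inner g (J f).
Proof.
intros (_ & _ & JI & JJ); rewrite <- (JJ f) at 1; apply JI.
Qed.

Lemma conjugation_bounded (J A : H2 -> H2) :
  conjugation J -> bounded_operator A -> bounded_operator (fun f => J (A (J f))).
Proof.
intros (JP & JS & JI & JJ) BA.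
assert (JN : forall f, H2_norm (J f) = H2_norm f).
{ intros f; unfold H2_norm; rewrite JI; reflexivity. }
split.
- intros f g; change (J (A (J (H2_plus f g))) = H2_plus (J (A (J f))) (J (A (J g)))).
  rewrite JP, op_plus, JP by exact BA; reflexivity.
- intros k f; change (J (A (J (H2_scal k f))) = H2_scal k (J (A (J f)))).
  rewrite JS, op_scal, JS, Cconj_conj by exact BA; reflexivity.
- destruct (linear_norm _ BA) as [M [M0 HM]]; exists M; split; [exact M0|].
  intros f; change (H2_norm (J (A (J f))) <= M * H2_norm f).
  rewrite JN, <- (JN f); apply HM.
Qed.

Lemma riesz_operator (A : H2 -> H2) (g : H2) :
  bounded_operator A -> exists r, forall f, inner (A f) g = inner f r.
Proof.
intros BA; destruct (linear_norm _ BA) as [M [M0 HM]].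
apply (riesz _ (M * H2_norm g)).
- intros f h; rewrite op_plus by exact BA; apply inner_plus_l.
- intros k f; rewrite op_scal by exact BA; apply inner_scal_l.
- intros f; apply Rle_trans with (1 := cauchy_schwarz _ _).
  replace (M * H2_norm g * H2_norm f) with (M * H2_norm f * H2_norm g) by ring.
  apply Rmult_le_compat_r; [apply H2_norm_ge0|apply HM].
Qed.

(** The identity is proved for [f] and [g] among the total eigenvectors, then
    extended to all [f] and finally, by its symmetry, to all [g].  Each extension
    compares [J (A (J g))] with the vector that represents [f |-> <A f, g>]. *)
Lemma commutant_symmetric (a : disk) (l : C) (T S J A : H2 -> H2) :
  triangular a l T -> 0 < Cmod l < 1 -> bounded_operator T ->
  conjugation J -> is_adjoint T S -> (forall f, J (T f) = S (J f)) ->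
  in_commutant T A ->
  forall f g, inner (A f) g = inner f (J (A (J g))).
Proof.
intros HT Hl BT HJ HS HJT [BA HA].
pose proof HJ as (JP & JS & JI & JJ).
set (eig := fun n v => S v = H2_scal (Cconj l ^ n)%C v).
assert (EJ : forall n v, eig n v -> T (J v) = H2_scal (l ^ n)%C (J v)).
{ intros n v Hv; rewrite <- (JJ (T (J v))), HJT, JJ, Hv, JS, Cpow_conj, Cconj_conj.
  reflexivity. }
assert (EA : forall n v, eig n v -> T (A (J v)) = H2_scal (l ^ n)%C (A (J v))).
{ intros n v Hv; rewrite <- HA, (EJ n v Hv), op_scal by exact BA; reflexivity. }
assert (J0 : J H2_zero = H2_zero).
{ rewrite <- (scal_0 H2_zero), JS; replace (Cconj (RtoC 0)) with (RtoC 0).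
  - rewrite !scal_0; reflexivity.
  - apply injective_projections; simpl; ring. }
(* [J] carries the total eigenvectors of [S] to eigenvectors of [T] *)
assert (total : forall f g,
  (forall n v, eig n v -> inner (J v) f = inner (J v) g) -> f = g).
{ intros f g H; apply H2_minus_eq0; rewrite <- (JJ (H2_minus f g)).
  rewrite (adjoint_eigenvectors_total a l T S (J (H2_minus f g)) HT Hl HS); [exact J0|].
  intros n v Hv; rewrite <- inner_conj, conjugation_inner_r, inner_conj by exact HJ.
  rewrite inner_minus_r, (H n v Hv); ring. }
(* within one eigenspace [A] has a single scalar; different eigenspaces of [T]
   are orthogonal for the form [<f, J g>] *)
assert (diag : forall n v n' v', eig n v -> eig n' v' ->
  inner (A (J v')) v = inner (J v') (J (A (J v)))).
{ intros n v n' v' Hv Hv'.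
  rewrite (conjugation_inner_r J (J v')), JJ by exact HJ.
  destruct (classic (J v' = H2_zero)) as [Z'|Z'].
  { rewrite Z', op_zero by exact BA.
    replace v' with H2_zero by (rewrite <- (JJ v'), Z', J0; reflexivity).
    rewrite inner_zero_l, inner_zero_r; reflexivity. }
  destruct (eigenspace_dim1 a l T n' _ _ BT HT Hl (EJ _ _ Hv') (EA _ _ Hv') Z')
    as [x' Ex'].
  assert (EAv : n = n' -> A (J v) = H2_scal x' (J v)).
  { intros <-.
    destruct (eigenspace_dim1 a l T n _ _ BT HT Hl (EJ _ _ Hv') (EJ _ _ Hv) Z')
      as [c Ec].
    rewrite Ec, op_scal, Ex' by exact BA; apply H2_ext; intros z; simpl; ring. }
  assert (Sym : inner (J v') v = inner (J v) v').
  { rewrite <- (JJ v) at 1; apply JI. }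
  rewrite Ex', inner_scal_l, Sym.
  destruct (Nat.eq_dec n n') as [E|E].
  { rewrite (EAv E), inner_scal_l; reflexivity. }
  destruct (classic (J v = H2_zero)) as [Z|Z].
  { rewrite Z, op_zero, !inner_zero_l by exact BA; ring. }
  destruct (eigenspace_dim1 a l T n _ _ BT HT Hl (EJ _ _ Hv) (EA _ _ Hv) Z) as [x Ex].
  assert (O : inner (J v) v' = RtoC 0).
  { destruct HS as [_ HS]; pose proof (HS (J v) v') as P.
    rewrite (EJ n v Hv), Hv', inner_scal_l, inner_scal_r, Cpow_conj, Cconj_conj in P.
    apply Cmult_cancel with (2 := P); intros E'; exact (E (Cpow_inj l n n' Hl E')). }
  rewrite Ex, inner_scal_l, O; ring. }
assert (half : forall n v f, eig n v -> inner (A f) v = inner f (J (A (J v)))).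
{ intros n v f Hv; destruct (riesz_operator A v BA) as [r Hr].
  rewrite Hr; f_equal; apply total; intros n' v' Hv'.
  rewrite <- Hr; exact (diag n v n' v' Hv Hv'). }
intros f g; destruct (riesz_operator A g BA) as [r Hr].
rewrite Hr; f_equal; apply total; intros n v Hv; rewrite <- Hr.
rewrite (conjugation_inner_r J (J v)), JJ, (half n v _ Hv) by exact HJ.
rewrite <- (JJ (A (J v))) at 1; symmetry; rewrite <- (JJ g) at 1.
rewrite JJ, (conjugation_inner_r J (J g)), !JJ by exact HJ; reflexivity.
Qed.

Theorem theorem1p5 (phi : disk -> disk) (C_phi : H2 -> H2) :
  schroder_map phi ->
  is_composition_operator phi C_phi ->
  complex_symmetric C_phi ->
  forall A : H2 -> H2, in_commutant C_phi A -> complex_symmetric A.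
Proof.
intros [_ (a & l & Ha & Hd & Hl)] HC [BC (J & S & HJ & HS & HJC)] A HA.
pose proof (composition_triangular phi C_phi a l HC Ha Hd) as HT.
split; [exact (proj1 HA)|].
exists J, (fun f => J (A (J f))); split; [exact HJ|split; [split|]].
- exact (conjugation_bounded J A HJ (proj1 HA)).
- exact (commutant_symmetric a l C_phi S J A HT Hl BC HJ HS HJC HA).
- intros f; destruct HJ as (_ & _ & _ & JJ); rewrite JJ; reflexivity.
Qed.
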